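(* Let $n\ge1$. The set $$\mathfrak{I}_n:=\{W(T)\ ;\ T \text{ is a Riordan tree of order } n\}$$ forms a basis for $\mathrm{Inv}(sl_2^{\otimes n})$, where $W$ is the $sl_2$ weight system.
   Context: The Lie algebra $sl_2$ over $\mathbb{Q}$ has basis $h,e,f$ with $[h,e]=2e$, $[h,f]=-2f$, $[e,f]=h$. $\mathrm{Inv}(sl_2^{\otimes n})$ is the space of tensors in the $n$-fold tensor power of the adjoint representation that are mapped to zero by $h,e,f$. A Jacobi diagram is a finite unitrivalent graph (vertices of valence 1 or 3), each trivalent vertex being equipped with a cyclic ordering of its three incident half-edges, and each connected component having at least one univalent vertex. A tree is a Jacobi diagram without cycles. An internal edge is an edge connecting two trivalent vertices. A linear tree with labels $i_1,\ldots,i_k$ (distinct, $k\ge2$) is the connected tree which for $k=2$ is a single edge (strut) with endpoints labeled $i_1,i_2$, and for $k\ge3$ consists of a path from a univalent vertex labeled $i_1$ to a univalent vertex labeled $i_k$ through $k-2$ trivalent vertices $t_2,\ldots,t_{k-1}$ in this order, with a leg labeled $i_j$ attached to $t_j$; the cyclic order at $t_j$ is (half-edge towards $i_1$, leg $i_j$, half-edge towards $i_k$). It is ordered if $i_1<i_2<\cdots<i_k$. A Riordan partition of $\{1,\ldots,n\}$ is a partition into parts each containing at least two elements and whose convex hulls are disjoint when the points $1,\ldots,n$ are arranged (in this order) on a circle. A Riordan tree of order $n$ is a disjoint union of ordered linear trees whose label sets form a Riordan partition of $\{1,\ldots,n\}$. Let $\kappa\colon sl_2\otimes sl_2\to\mathbb{Q}$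 be the symmetric bilinear form with $\kappa(h,h)=2$, $\kappa(e,f)=1$, $\kappa(h,e)=\kappa(h,f)=\kappa(e,e)=\kappa(f,f)=0$; let $c=\frac12 h\otimes h+f\otimes e+e\otimes f$ and $b=h\otimes e\otimes f+e\otimes f\otimes h+f\otimes h\otimes e-h\otimes f\otimes e-f\otimes e\otimes h-e\otimes h\otimes f$. For a tree $T$ in which each label $1,\ldots,n$ appears exactly once on univalent vertices, $W(T)\in \mathrm{Inv}(sl_2^{\otimes n})$ is obtained as follows: to each strut component with labels $i,j$ associate $c$ with its two factors in positions $i$ and $j$; in each other component, attach a copy of $b$ to each trivalent vertex, its three tensor factors being associated to the three half-edges following the cyclic order, contract by $\kappa$ the two factors on each internal edge, and put the factor of the $j$-labeled vertex in position $j$; finally take the tensor product over all components (each position $1,\ldots,n$ being filled exactly once). *)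

(* Defs.v *)
From HB Require Import structures.
From mathcomp Require Import all_boot all_order all_algebra.
From mathcomp Require Import reals.

Set Implicit Arguments.
Unset Strict Implicit.
Unset Printing Implicit Defensive.

Import Order.TTheory GRing.Theory Num.Theory.
Local Open Scope ring_scope.

(* 'I_3 indexes the basis h, e, f of sl_2. *)
Definition sl2_h : 'I_3 := @Ordinal 3 0 isT.
Definition sl2_e : 'I_3 := @Ordinal 3 1 isT.
Definition sl2_f : 'I_3 := @Ordinal 3 2 isT.

(* Coordinates of the elementary tensors a (x) b and a (x) b (x) c. *)
Definition elem2 (a b x y : 'I_3) : rat := ((x == a) && (y == b))%:R.
Definition elem3 (a b c x y z : 'I_3) : rat :=
  [&& x == a, y == b & z == c]%:R.

(* Coefficient of the basis vector z in [x, y]: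
   [h,e] = 2e, [h,f] = -2f, [e,f] = h. *)
Definition bracket_coef (x y z : 'I_3) : rat :=
  let t a b c := elem3 a b c x y z in
  2 * (t sl2_h sl2_e sl2_e - t sl2_e sl2_h sl2_e)
  - 2 * (t sl2_h sl2_f sl2_f - t sl2_f sl2_h sl2_f)
  + (t sl2_e sl2_f sl2_h - t sl2_f sl2_e sl2_h).

Definition kappa (x y : 'I_3) : rat :=
  let t a b := elem2 a b x y in
  2 * t sl2_h sl2_h + t sl2_e sl2_f + t sl2_f sl2_e.

Definition c_coef (x y : 'I_3) : rat :=
  let t a b := elem2 a b x y in
  2^-1 * t sl2_h sl2_h + t sl2_f sl2_e + t sl2_e sl2_f.

Definition b_coef (x y z : 'I_3) : rat :=
  let t a b c := elem3 a b c x y z in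
  t sl2_h sl2_e sl2_f + t sl2_e sl2_f sl2_h + t sl2_f sl2_h sl2_e
  - t sl2_h sl2_f sl2_e - t sl2_f sl2_e sl2_h - t sl2_e sl2_h sl2_f.

(* Multi-indices of the elementary basis tensors of sl_2^{(x) n}. *)
Definition mindex (n : nat) := {ffun 'I_n -> 'I_3}.

(* sl_2^{(x) n}: a tensor is given by its coordinates. *)
Definition tensor (n : nat) := {ffun mindex n -> rat^o}.

Definition subst_at n (s : mindex n) (i : 'I_n) (y : 'I_3) : mindex n :=
  [ffun j => if j == i then y else s j].

(* The basis vector x acts by the Leibniz rule, through ad x in each factor. *)
Definition ad_act n (x : 'I_3) (t : tensor n) : tensor n :=
  [ffun s : mindex n =>
     \sum_(i < n) \sum_(y : 'I_3)
        bracket_coef x y (s i) * t (subst_at s i y)].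

Fact ad_act_is_linear n x : linear (@ad_act n x).
Proof.
move=> a u v; apply/ffunP => s; rewrite !ffunE scaler_sumr -big_split /=.
apply: eq_bigr => i _; rewrite scaler_sumr -big_split /=.
apply: eq_bigr => y _; rewrite !ffunE mulrDr; congr (_ + _).
exact: mulrCA.
Qed.

HB.instance Definition _ n x :=
  GRing.isLinear.Build rat (tensor n) (tensor n) _ (@ad_act n x)
    (ad_act_is_linear (n := n) x).

Definition Inv (n : nat) : {vspace tensor n} :=
  (\bigcap_(x : 'I_3) lker (linfun (@ad_act n x)))%VS.

Lemma mem_Inv n (t : tensor n) :
  reflect (forall x : 'I_3, ad_act x t = 0) (t \in Inv n).
Proof.
apply: (iffP idP) => [|t0].
  rewrite memvE => /subv_bigcapP tI x.
  by have := tI x isT; rewrite -memvE memv_ker lfunE => /eqP.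
rewrite memvE; apply/subv_bigcapP => x _.
by rewrite -memvE memv_ker lfunE /= t0.
Qed.

Definition set_is_basis (K : fieldType) (vT : vectType K) (U : {vspace vT})
    (S : vT -> Prop) : Prop :=
  exists2 X : seq vT, (forall v, v \in X <-> S v) & basis_of U X.

(* Jacobi diagrams whose univalent vertices carry each label of 'I_n (that is,
   1, ..., n shifted to 0, ..., n-1) exactly once. A diagram is given by its
   half-edges: [opp h] is the other half of the edge of h, and [nxt h] follows h
   in the cyclic order of its vertex. The vertices are the orbits of nxt, which
   have size 1 (univalent vertices) or 3 (trivalent vertices); [leg i] is the
   half-edge at the univalent vertex labeled i. *)
Record jacobi_diagram (n : nat) := JacobiDiagram {
  half_edge : finType;
  opp : half_edge -> half_edge;
  nxt : half_edge -> half_edge;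
  leg : 'I_n -> half_edge;
  oppK : involutive opp;
  opp_neq : forall h, opp h != h;
  nxt3 : forall h, nxt (nxt (nxt h)) = h;
  leg_inj : injective leg;
  legP : forall h, (nxt h == h) = (h \in codom leg);
  component_has_leg : forall h, exists i,
    connect (fun x y => (y == opp x) || (y == nxt x)) h (leg i) }.

Arguments opp {n} T : rename.
Arguments nxt {n} T : rename.
Arguments leg {n} T : rename.

Section Diagram.
Variables (n : nat) (T : jacobi_diagram n).
Implicit Types h : half_edge T.

Definition trivalent h := nxt T h != h.

(* One half-edge per edge, resp. per trivalent vertex. The choice is immaterial
   in the products below: kappa and c are symmetric and b is invariant under
   cyclic permutations. *)
Definition edge_rep h := (enum_rank h < enum_rank (opp T h))%N.
Definition vertex_rep h :=
  [&& trivalent h, (enum_rank h < enum_rank (nxt T h))%N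
    & (enum_rank h < enum_rank (nxt T (nxt T h)))%N].

(* Struts carry c and internal edges are contracted by kappa. On an edge joining
   a trivalent vertex to the univalent vertex labeled j, the factor of b at the
   trivalent end is transported unchanged to position j. *)
Definition edge_weight (x : {ffun half_edge T -> 'I_3}) h : rat :=
  match trivalent h, trivalent (opp T h) with
  | true, true => kappa (x h) (x (opp T h))
  | false, false => c_coef (x h) (x (opp T h))
  | _, _ => (x h == x (opp T h))%:R
  end.

(* The weight system in coordinates, as a state sum over the colorings of the
   half-edges by basis vectors: the coordinate at s sums over the colorings
   equal to s i on the half-edge labeled i. *)
Definition W : tensor n :=
  [ffun s : mindex n =>
     \sum_(x : {ffun half_edge T -> 'I_3} | [forall i, x (leg T i) == s i])
        (\prod_(h | vertex_rep h)
            b_coef (x h) (x (nxt T h)) (x (nxt T (nxt T h))))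
        * \prod_(h | edge_rep h) edge_weight x h].

(* [path_from h [:: i_j; ...; i_k]]: the edge leaving through h leads to t_j, the
   vertex carrying the leg i_j, from which the path goes on to t_{j+1}, ..., and
   ends at the univalent vertex i_k. At t_j, with g the half-edge of the leg,
   the cyclic order (towards i_1, g, towards i_k) makes nxt g the half-edge
   towards i_k and nxt (nxt g) the one towards i_1. *)
Fixpoint path_from h (s : seq 'I_n) : bool :=
  match s with
  | [::] => false
  | [:: i] => opp T h == leg T i
  | i :: s' => let g := opp T (leg T i) in
      [&& trivalent g, opp T h == nxt T (nxt T g) & path_from (nxt T g) s']
  end.

(* T has a component which is the linear tree with labels s = i_1, ..., i_k;
   k >= 2 since path_from fails on the empty sequence. *)
Definition linear_component (s : seq 'I_n) : bool :=
  if s is i :: s' then uniq s && path_from (leg T i) s' else false.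

Definition ordered_labels (s : seq 'I_n) : bool :=
  sorted (fun i j : 'I_n => (i < j)%N) s.

End Diagram.

Section Riordan.
Variables (R : realType) (n : nat).

(* The points of the unit circle of angles 2 arctan i, i = 0, ..., n-1: they are
   met in this order when running along the circle. *)
Definition circle_point (i : 'I_n) : R * R :=
  let t : R := (i : nat)%:R in
  ((1 - t ^+ 2) / (1 + t ^+ 2), 2 * t / (1 + t ^+ 2)).

Definition in_hull (B : {set 'I_n}) (p : R * R) : Prop :=
  exists w : 'I_n -> R,
    [/\ forall i, i \in B -> 0 <= w i,
        \sum_(i in B) w i = 1,
        p.1 = \sum_(i in B) w i * (circle_point i).1
      & p.2 = \sum_(i in B) w i * (circle_point i).2].

Definition riordan_partition (P : {set {set 'I_n}}) : Prop :=
  [/\ partition P [set: 'I_n],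
      forall B, B \in P -> (2 <= #|B|)%N
    & forall B C, B \in P -> C \in P -> B != C ->
        forall p, ~ (in_hull B p /\ in_hull C p)].

(* As every component of T has a univalent vertex, the components listed here
   exhaust T. *)
Definition riordan_tree (T : jacobi_diagram n) : Prop :=
  exists2 P : {set {set 'I_n}}, riordan_partition P &
    forall B, B \in P -> exists s : seq 'I_n,
      [/\ s =i B, ordered_labels s & linear_component T s].

End Riordan.

(* Main.v *)
From HB Require Import structures.
Require Import Defs.
From mathcomp Require Import all_boot all_order all_algebra.
From mathcomp Require Import reals ring zify.

(** The weight of a Riordan tree depends only on its partition P.  Summing over the
colorings along each path, the coordinate of W T at a word s (a choice of a basis
vector h, e or f at each position) is the product over the blocks B of P of a
number [linear_coef], an iterated matrix product in the letters of s on B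
([riordan_tree_weight]).  Chords of a circle with four distinct ends meet exactly when
their ends alternate, so the partitions that occur are the noncrossing ones without
singletons ([riordan_partitionE]), and each of them does occur
([partition_diagram]).  It remains to see that the tensors [partition_tensor P], for
these P, form a basis of the invariants.  They are invariant because c, b and kappa
are ([partition_tensor_Inv]).

Both independence and generation come from one word attached to P: it has f at the
least element of each block, e at the greatest one, h elsewhere ([partition_word]).

Independence.  Give e, f, h the charges 1, -1, 0.  If the coordinate of a linear tree
at a word is nonzero, then the partial sums of the charges along the block stay
between -1 and 1 and end at 0.  Hence the sum of i times the charge of the letter at
i, over all positions i, is largest at the word of P, and only there, among the words
in the support of [partition_tensor P] ([word_height]).  As different P have
different words ([partition_word_inj]), a linear relation is contradicted at the
highest word that occurs in it ([free_partition_tensor]).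

Generation.  Read a word as a path with an up step for f, a level step for h and a
down step for e; call it admissible if it ends at level 0 and has no level or down
step from level 0.  An invariant tensor vanishing at all admissible words is zero
([Inv_admissible]).  This is the decomposition of the product of the irreducible
representation V_m of highest weight 2m with the adjoint one into V_(m+1), V_m and
V_(m-1), where only the first one is present for m = 0: the three slices of a highest
weight tensor along its first factor are, successively, zero or highest weight
tensors for these three weights.  So the invariants have at most as many dimensions
as there are admissible words ([dim_Inv]).  Finally every admissible word is the word
of a noncrossing partition without singletons, obtained by linking the positions at
the same depth between which the path does not go lower ([linked_partition_word]), so
there are enough tensors ([card_admissible]). *)

Set Implicit Arguments.
Unset Strict Implicit.
Unset Printing Implicit Defensive.

Import Order.TTheory GRing.Theory Num.Theory.
Local Open Scope ring_scope.

(** * Linear trees and the invariance of partition tensors *)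

Lemma sl2_ind (Q : 'I_3 -> Prop) :
  Q sl2_h -> Q sl2_e -> Q sl2_f -> forall x, Q x.
Proof.
move=> Qh Qe Qf [[|[|[|//]]] lt_i3].
- by rewrite (_ : Ordinal _ = sl2_h) //; apply/val_inj.
- by rewrite (_ : Ordinal _ = sl2_e) //; apply/val_inj.
- by rewrite (_ : Ordinal _ = sl2_f) //; apply/val_inj.
Qed.

Lemma sum_sl2 (V : nmodType) (F : 'I_3 -> V) :
  \sum_x F x = F sl2_h + F sl2_e + F sl2_f.
Proof.
rewrite !big_ord_recl big_ord0 addr0 addrA.
by congr (F _ + F _ + F _); apply/val_inj.
Qed.

(** The tensor b with its last factor lowered by kappa: the transfer matrix of one
trivalent vertex of a linear tree together with the internal edge that follows it. *)
Definition bmat x y v := \sum_u b_coef x y u * kappa u v.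

(** The invariance of b and kappa; the index v is dual, hence the other side. *)
Lemma bmat_inv x a y v :
  \sum_z bracket_coef x z y * bmat a z v + \sum_z bracket_coef x z a * bmat z y v
  = \sum_z bmat a y z * bracket_coef x v z.
Proof.
rewrite /bmat !sum_sl2.
by move: x a y v; do 4!elim/sl2_ind; apply/eqP; vm_compute.
Qed.

Lemma c_inv x a y :
  \sum_z bracket_coef x z y * c_coef a z = - \sum_z bracket_coef x z a * c_coef z y.
Proof.
rewrite !sum_sl2.
by move: x a y; do 3!elim/sl2_ind; apply/eqP; vm_compute.
Qed.

(** The coordinates of a linear tree.  The last step uses c also after a trivalent
vertex: contracting c with kappa gives the identity, so that [bmat] followed by c is
the last copy of b. *)
Fixpoint chain_coef (x : 'I_3) (u : seq 'I_3) : rat :=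
  match u with
  | [::] => 0
  | [:: z] => c_coef x z
  | y :: u' => \sum_v bmat x y v * chain_coef v u'
  end.

Definition linear_coef (u : seq 'I_3) : rat :=
  if u is x :: u' then chain_coef x u' else 0.

Lemma chain_coef_cons x y z u :
  chain_coef x [:: y, z & u] = \sum_v bmat x y v * chain_coef v (z :: u).
Proof. by []. Qed.

(** The Leibniz action on functions of words, by recursion on the first letter, in
order to slice a tensor along its first factor. *)
Fixpoint word_act (x : 'I_3) (T : seq 'I_3 -> rat) (w : seq 'I_3) : rat :=
  if w is y :: w' then
    \sum_z bracket_coef x z y * T (z :: w')
      + word_act x (fun w'' => T (y :: w'')) w'
  else 0.

Lemma eq_word_act x T U w :
  (forall w', size w' = size w -> T w' = U w') ->
  word_act x T w = word_act x U w.
Proof.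
elim: w T U => [//|y w IHw] T U eqTU /=; congr (_ + _).
  by apply: eq_bigr => z _; rewrite eqTU.
by apply: IHw => w' sz; rewrite eqTU //= sz.
Qed.

Lemma word_act_sum (I : Type) (r : seq I) (a : I -> rat) x
    (T : I -> seq 'I_3 -> rat) w :
  word_act x (fun w' => \sum_(i <- r) a i * T i w') w =
  \sum_(i <- r) a i * word_act x (T i) w.
Proof.
elim: w T => [|y w IHw] T /=; first by rewrite big1 // => i _; rewrite mulr0.
rewrite IHw.
under [in RHS]eq_bigr do rewrite mulrDr mulr_sumr.
rewrite big_split exchange_big /=; congr (_ + _).
apply: eq_bigr => z _; rewrite mulr_sumr.
by apply: eq_bigr => i _; rewrite mulrCA.
Qed.

(** The action on the letters of [u] is compensated by the action on the incoming
index [a]; this is carried from one vertex to the next by [bmat_inv]. *)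
Lemma chain_coef_act x a y u :
  word_act x (chain_coef a) (y :: u) =
  - \sum_z bracket_coef x z a * chain_coef z (y :: u).
Proof.
elim: u a y => [|y' u IHu] a y; first by rewrite /= addr0 c_inv.
rewrite -[LHS]/(\sum_z bracket_coef x z y * chain_coef a [:: z, y' & u]
  + word_act x (fun w => chain_coef a (y :: w)) (y' :: u)).
rewrite (@eq_word_act _ _ (fun w => \sum_v bmat a y v * chain_coef v w)).
  2: by case.
rewrite word_act_sum.
under [X in _ + X]eq_bigr do rewrite IHu mulrN.
rewrite sumrN.
apply/eqP; rewrite -subr_eq0 opprK addrAC subr_eq0; apply/eqP.
under [X in X + _ = _]eq_bigr do rewrite chain_coef_cons mulr_sumr.
under [X in _ + X = _]eq_bigr do rewrite chain_coef_cons mulr_sumr.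
under [RHS]eq_bigr do rewrite mulr_sumr.
rewrite exchange_big [X in _ + X]exchange_big [RHS]exchange_big /= -big_split /=.
apply: eq_bigr => v _.
do !(under eq_bigr do rewrite mulrA); rewrite -!mulr_suml.
under [X in _ + X]eq_bigr do rewrite mulrA.
under [RHS]eq_bigr do rewrite mulrA.
by rewrite -!mulr_suml -mulrDl bmat_inv.
Qed.

Lemma linear_coef_act x u : (1 < size u)%N -> word_act x linear_coef u = 0.
Proof.
case: u => [|a [|y u]] // _.
rewrite -[LHS]/(\sum_z bracket_coef x z a * chain_coef z (y :: u)
  + word_act x (chain_coef a) (y :: u)).
by rewrite chain_coef_act subrr.
Qed.

Lemma sum_subst_at n x (s : mindex n) (T : seq 'I_3 -> rat) (l : seq 'I_n) :
  uniq l ->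
  \sum_(i <- l) \sum_y bracket_coef x y (s i) * T (map (subst_at s i y) l) =
  word_act x T (map s l).
Proof.
elim: l T => [|i l IHl] T /=; first by rewrite big_nil.
case/andP=> il ul; rewrite big_cons; congr (_ + _).
  apply: eq_bigr => y _; rewrite ffunE eqxx; congr (_ * T (_ :: _)).
  by apply/eq_in_map => j jl; rewrite ffunE; case: eqP jl il => // -> ->.
rewrite -(IHl (fun w => T (s i :: w)) ul); apply: eq_big_seq => j jl.
apply: eq_bigr => y _; rewrite ffunE.
by case: eqP jl il => // -> ->.
Qed.

Definition partition_tensor n (P : {set {set 'I_n}}) : tensor n :=
  [ffun s : mindex n => \prod_(B in P) linear_coef [seq s i | i <- enum B]].

(** By the Leibniz rule the action is a sum over the blocks, and the terms of one
block add up to the action on its linear tree, which vanishes. *)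
Lemma partition_tensor_Inv n (P : {set {set 'I_n}}) :
  partition P [set: 'I_n] -> (forall B, B \in P -> (2 <= #|B|)%N) ->
  partition_tensor P \in Inv n.
Proof.
move=> /and3P[/eqP covP tiP _] P2; apply/mem_Inv => x; apply/ffunP => s.
rewrite !ffunE (eq_bigl (mem (cover P))) ?big_trivIset //=; last first.
  by move=> i /=; rewrite covP; exact: esym (in_setT i).
apply: big1 => B BP.
rewrite (eq_bigr (fun i => (\prod_(C in P | C != B) linear_coef [seq s i | i <- enum C])
  * \sum_y bracket_coef x y (s i) * linear_coef (map (subst_at s i y) (enum B)))).
  rewrite -mulr_sumr -[X in _ * X]big_enum sum_subst_at ?enum_uniq //.
  by rewrite linear_coef_act ?mulr0 // size_map -cardE P2.
move=> i iB; rewrite mulr_sumr; apply: eq_bigr => y _.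
rewrite ffunE (bigD1 B) //= [RHS]mulrCA; congr (_ * _); rewrite mulrC; congr (_ * _).
apply: eq_bigr => C /andP[CP CB]; congr linear_coef; apply/eq_in_map => j.
rewrite mem_enum ffunE; case: eqP => // -> iC.
have /trivIsetP/(_ B C BP CP) := tiP; rewrite eq_sym => /(_ CB).
by move/disjoint_setI0/setP/(_ i); rewrite !inE iB iC.
Qed.

(** * Invariants are determined by their admissible coordinates *)

Lemma word_actD x T U w :
  word_act x (fun w' => T w' + U w') w = word_act x T w + word_act x U w.
Proof.
elim: w T U => [|y w IHw] T U /=; first by rewrite addr0.
rewrite IHw addrACA -big_split /=; congr (_ + _).
by apply: eq_bigr => z _; rewrite mulrDr.
Qed.

(** The Jacobi identity. *)
Lemma jacobi_bracket x y c z :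
  \sum_v (bracket_coef x v c * bracket_coef y z v
        - bracket_coef y v c * bracket_coef x z v) =
  \sum_v bracket_coef x y v * bracket_coef v z c.
Proof.
by rewrite !sum_sl2; move: x y c z; do 4!elim/sl2_ind; apply/eqP; vm_compute.
Qed.

Lemma word_act_bracket x y T w :
  word_act x (word_act y T) w - word_act y (word_act x T) w =
  \sum_v bracket_coef x y v * word_act v T w.
Proof.
elim: w T => [|c w IHw] T /=.
  by rewrite subrr big1 // => v _; rewrite mulr0.
rewrite !word_actD !word_act_sum.
under [X in X + _ - _]eq_bigr do rewrite mulrDr mulr_sumr.
under [X in _ - (X + _)]eq_bigr do rewrite mulrDr mulr_sumr.
under [RHS]eq_bigr do rewrite mulrDr mulr_sumr.
rewrite !big_split /= -IHw.
have -> (p q r p' q' r' : rat) :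
    p + q + (r + p') - (q' + r + (q + r')) = (p - q') + (p' - r') by ring.
congr (_ + _).
rewrite exchange_big [X in _ - X]exchange_big [RHS]exchange_big /= -sumrB.
apply: eq_bigr => z _.
under [RHS]eq_bigr do rewrite mulrA.
rewrite -sumrB -mulr_suml -jacobi_bracket mulr_suml; apply: eq_bigr => v _.
by rewrite mulrBl !mulrA.
Qed.

Lemma bracket_ef v : bracket_coef sl2_e sl2_f v = (v == sl2_h)%:R.
Proof. by move: v; elim/sl2_ind; apply/eqP; vm_compute. Qed.

Lemma word_act_ef T w :
  word_act sl2_e (word_act sl2_f T) w =
  word_act sl2_f (word_act sl2_e T) w + word_act sl2_h T w.
Proof.
have := word_act_bracket sl2_e sl2_f T w.
rewrite sum_sl2 !bracket_ef mul1r !mul0r !addr0 => <-.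
by rewrite addrC subrK.
Qed.

Definition sl2_norm (x : 'I_3) : rat := if x == sl2_h then 2 else 1.

(** The positive definite form for which e and f are adjoint to each other: the
basis h, e, f is orthogonal with squared norms 2, 1, 1. *)
Fixpoint dot n (T U : seq 'I_3 -> rat) : rat :=
  if n is n'.+1 then
    \sum_x sl2_norm x * dot n' (fun w => T (x :: w)) (fun w => U (x :: w))
  else T [::] * U [::].

Lemma eq_dot n T T' U U' :
  (forall w, size w = n -> T w = T' w) -> (forall w, size w = n -> U w = U' w) ->
  dot n T U = dot n T' U'.
Proof.
elim: n T T' U U' => [|n IHn] T T' U U' eqT eqU /=; first by rewrite eqT ?eqU.
apply: eq_bigr => x _; congr (_ * _).
by apply: IHn => w sz; rewrite ?eqT ?eqU //= sz.
Qed.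

Lemma dotC n T U : dot n T U = dot n U T.
Proof.
elim: n T U => [|n IHn] T U /=; first exact: mulrC.
by apply: eq_bigr => x _; rewrite IHn.
Qed.

Lemma dotDl n T T' U : dot n (fun w => T w + T' w) U = dot n T U + dot n T' U.
Proof.
elim: n T T' U => [|n IHn] T T' U /=; first exact: mulrDl.
by rewrite -big_split; apply: eq_bigr => x _; rewrite IHn mulrDr.
Qed.

Lemma dotZl n a T U : dot n (fun w => a * T w) U = a * dot n T U.
Proof.
elim: n T U => [|n IHn] T U /=; first by rewrite mulrA.
by rewrite mulr_sumr; apply: eq_bigr => x _; rewrite IHn mulrCA.
Qed.

Lemma dot_suml n (I : Type) (r : seq I) (T : I -> seq 'I_3 -> rat) U :
  dot n (fun w => \sum_(i <- r) T i w) U = \sum_(i <- r) dot n (T i) U.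
Proof.
elim: r => [|i r IHr].
  rewrite big_nil -[RHS](mul0r (dot n (fun=> 0) U)) -dotZl.
  by apply: eq_dot => // w _; rewrite big_nil mul0r.
rewrite big_cons -IHr -dotDl; apply: eq_dot => // w _; by rewrite big_cons.
Qed.

Lemma dot_ge0 n T : 0 <= dot n T T.
Proof.
elim: n T => [|n IHn] T /=; first by rewrite -expr2 sqr_ge0.
apply: sumr_ge0 => x _; apply: mulr_ge0 => //.
by rewrite /sl2_norm; case: ifP.
Qed.

Lemma dot_eq0 n T : dot n T T = 0 -> forall w, size w = n -> T w = 0.
Proof.
elim: n T => [|n IHn] T /=.
  by move=> /eqP; rewrite mulf_eq0 orbb => /eqP T0 [].
move=> /eqP; rewrite psumr_eq0 => [/allP T0|x _]; last first.
  by rewrite mulr_ge0 ?dot_ge0 // /sl2_norm; case: ifP.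
case=> [|x w] //= [sz]; apply: (IHn (fun w => T (x :: w))) => //.
have /implyP/(_ isT) := T0 x (mem_index_enum x).
by rewrite mulf_eq0 /sl2_norm; case: ifP => _ /= /eqP.
Qed.

Lemma norm_bracket x z :
  sl2_norm x * bracket_coef sl2_e z x = sl2_norm z * bracket_coef sl2_f x z.
Proof. by move: x z; do 2!elim/sl2_ind; apply/eqP; vm_compute. Qed.

Lemma dot_adjoint n T U : dot n (word_act sl2_e T) U = dot n T (word_act sl2_f U).
Proof.
elim: n T U => [|n IHn] T U /=; first by rewrite mul0r mulr0.
under eq_bigr do rewrite dotDl dot_suml mulrDr mulr_sumr IHn.
under [RHS]eq_bigr do rewrite dotC dotDl dot_suml mulrDr mulr_sumr [X in _ + _ * X]dotC.
rewrite !big_split /=; congr (_ + _); rewrite exchange_big.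
apply: eq_bigr => z _; apply: eq_bigr => x _.
by rewrite !dotZl !mulrA norm_bracket dotC.
Qed.

(** If E T = 0 then <FT, FT> = <T, EFT> = <T, [e,f] T>. *)
Lemma dot_lowering n c T :
  (forall w, size w = n -> word_act sl2_e T w = 0) ->
  (forall w, size w = n -> word_act sl2_h T w = c * T w) ->
  dot n (word_act sl2_f T) (word_act sl2_f T) = c * dot n T T.
Proof.
move=> ET HT; rewrite -dot_adjoint -dotZl; apply: eq_dot => // w sz.
rewrite word_act_ef HT // (@eq_word_act _ _ (fun=> 0 * 0)); last first.
  by move=> w' sz'; rewrite ET ?mul0r // sz'.
rewrite -[RHS]add0r; congr (_ + _).
elim: (w) => //= y w' ->; rewrite addr0 big1 // => z _; by rewrite mul0r mulr0.
Qed.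

(** A highest weight vector has nonnegative weight: by [dot_lowering] the squared
norm of F T is otherwise a negative multiple of that of T. *)
Lemma highest_negative_eq0 n c T : c < 0 ->
  (forall w, size w = n -> word_act sl2_e T w = 0) ->
  (forall w, size w = n -> word_act sl2_h T w = c * T w) ->
  forall w, size w = n -> T w = 0.
Proof.
move=> c0 ET HT; apply: dot_eq0; apply/eqP; rewrite eq_le dot_ge0 andbT.
have := dot_ge0 n (word_act sl2_f T).
by rewrite (dot_lowering ET HT) nmulr_rge0.
Qed.

Lemma bracket_e z x : bracket_coef sl2_e z x =
  if (z == sl2_f) && (x == sl2_h) then 1
  else if (z == sl2_h) && (x == sl2_e) then - 2 else 0.
Proof. by move: z x; do 2!elim/sl2_ind; apply/eqP; vm_compute. Qed.

Lemma bracket_h z x : bracket_coef sl2_h z x =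
  if z == x then if x == sl2_f then - 2 else if x == sl2_e then 2 else 0 else 0.
Proof. by move: z x; do 2!elim/sl2_ind; apply/eqP; vm_compute. Qed.

(** The path read from [w], started at level [m], ends at level 0 and leaves level 0
only upwards. *)
Fixpoint admissible (m : nat) (w : seq 'I_3) : bool :=
  if w is x :: w' then
    if x == sl2_f then admissible m.+1 w'
    else (0 < m)%N && admissible (if x == sl2_h then m else m.-1) w'
  else m == 0%N.

(** Slice T along its first factor.  The slice at f is a highest weight tensor; once
it is zero, so is the slice at h; and once both are zero, so is the slice at e.  For
m = 0 the last two slices vanish without any condition on words, since
E (S e) = 2 (S h) has weight 0 and is killed by E. *)
Lemma highest_admissible n m T :
  (forall w, size w = n -> word_act sl2_e T w = 0) ->
  (forall w, size w = n -> word_act sl2_h T w = 2 * m%:R * T w) ->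
  (forall w, size w = n -> admissible m w -> T w = 0) ->
  forall w, size w = n -> T w = 0.
Proof.
elim: n m T => [|n IHn] m T ET HT T0.
  case=> // _; have /= /esym/eqP := HT [::] erefl; rewrite !mulf_eq0 /= orbC.
  by case/orP=> [/eqP //|m0]; apply: T0 => //=; rewrite -(pnatr_eq0 rat).
pose S x w := T (x :: w).
have ES w : size w = n ->
  [/\ word_act sl2_e (S sl2_f) w = 0, word_act sl2_e (S sl2_h) w = - S sl2_f w
    & word_act sl2_e (S sl2_e) w = 2 * S sl2_h w].
  move=> sz; have E x : size (x :: w) = n.+1 by rewrite /= sz.
  move: (ET _ (E sl2_f)) (ET _ (E sl2_h)) (ET _ (E sl2_e)).
  rewrite /= !sum_sl2 !bracket_e /= !mul0r !add0r !addr0 mul1r => -> Eh Ee.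
  by split=> //; [rewrite -[RHS]addr0 -Eh addKr | rewrite -[RHS]addr0 -Ee mulNr addNKr].
have HS w : size w = n ->
  [/\ word_act sl2_h (S sl2_f) w = 2 * m.+1%:R * S sl2_f w,
      word_act sl2_h (S sl2_h) w = 2 * m%:R * S sl2_h w
    & word_act sl2_h (S sl2_e) w = 2 * (m%:R - 1) * S sl2_e w].
  move=> sz; have E x : size (x :: w) = n.+1 by rewrite /= sz.
  move: (HT _ (E sl2_f)) (HT _ (E sl2_h)) (HT _ (E sl2_e)).
  rewrite /= !sum_sl2 !bracket_h /= !mul0r !add0r !addr0 /S -[m.+1]addn1 natrD.
  move=> Hf Hh He; split=> //.
  - by apply: (addrI (- 2 * T (sl2_f :: w))); rewrite Hf; ring.
  - by apply: (addrI (2 * T (sl2_e :: w))); rewrite He; ring.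
have Sf0 w : size w = n -> S sl2_f w = 0.
  apply: (IHn m.+1) w => w sz; try by case: (ES w sz) (HS w sz) => ? ? ? [].
  by move=> aw; apply: T0; rewrite //= sz.
have ESh w : size w = n -> word_act sl2_e (S sl2_h) w = 0.
  by move=> sz; case: (ES w sz) => _ -> _; rewrite Sf0 ?oppr0.
have Sh0 w : size w = n -> S sl2_h w = 0.
  case: (posnP m) => [m0|m_gt0]; last first.
    apply: (IHn m) w => // w sz; first by case: (HS w sz).
    by move=> aw; apply: T0; rewrite //= ?sz ?m_gt0.
  (* Here S h has weight 0 and is killed by E, hence by F; so E (S e) = 2 (S h) is
     orthogonal to itself: <E (S e), E (S e)> = <S e, F E (S e)> = 0. *)
  have FSh0 w' : size w' = n -> word_act sl2_f (S sl2_h) w' = 0.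
    apply: dot_eq0; rewrite (@dot_lowering _ 0) ?mul0r // => w'' sz.
    by case: (HS w'' sz) => _ -> _; rewrite m0 mulr0 !mul0r.
  have ESe w' : size w' = n -> word_act sl2_e (S sl2_e) w' = 0.
    apply: dot_eq0; rewrite dot_adjoint dotC.
    rewrite (@eq_dot _ _ (fun w => 0 * 0) _ (S sl2_e)) ?dotZl ?mul0r // => w'' sz.
    rewrite (@eq_word_act _ _ (fun w => \sum_(i <- [:: tt]) 2 * S sl2_h w)).
      by rewrite word_act_sum big_seq1 FSh0 ?mulr0 ?mul0r.
    by move=> w3 sz3; rewrite big_seq1; case: (ES w3); rewrite ?sz3.
  move=> sz; case: (ES w sz) => _ _; rewrite ESe // => /esym/eqP.
  by rewrite mulf_eq0 /= => /eqP.
have Se0 w : size w = n -> S sl2_e w = 0.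
  have ESe w' : size w' = n -> word_act sl2_e (S sl2_e) w' = 0.
    by move=> sz; case: (ES w' sz) => _ _ ->; rewrite Sh0 ?mulr0.
  case: (posnP m) => [m0|m_gt0].
    apply: (@highest_negative_eq0 _ (- 2)) w => // w sz.
    by case: (HS w sz) => _ _ ->; rewrite m0 sub0r mulrN1.
  apply: (IHn m.-1) w => // w sz.
    by case: (HS w sz) => _ _ ->; rewrite -subn1 natrB.
  by move=> aw; apply: T0; rewrite //= ?sz ?m_gt0.
case=> // x w [sz]; rewrite -/(S x w).
by elim/sl2_ind: x; [exact: Sh0 | exact: Se0 | exact: Sf0].
Qed.

Definition word n (s : mindex n) : seq 'I_3 := [seq s i | i <- enum 'I_n].

Lemma word_ffun n (w : seq 'I_3) :
  size w = n -> word [ffun i : 'I_n => nth sl2_h w i] = w.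
Proof.
move=> sz; rewrite /word (eq_map (g := nth sl2_h w \o val)); last first.
  by move=> i; rewrite ffunE.
by rewrite map_comp val_enum_ord -sz map_nth_iota0 // take_size.
Qed.

Lemma ffun_word n (s : mindex n) : [ffun i : 'I_n => nth sl2_h (word s) i] = s.
Proof.
apply/ffunP => i; rewrite ffunE (nth_map i) ?size_enum_ord //.
by rewrite nth_ord_enum.
Qed.

Lemma Inv_admissible n (t : tensor n) : t \in Inv n ->
  (forall s, admissible 0 (word s) -> t s = 0) -> t = 0.
Proof.
move=> /mem_Inv tI t0.
pose T w : rat := t [ffun i : 'I_n => nth sl2_h w i].
have tT s : t s = T (word s) by rewrite /T ffun_word.
have actT x w : size w = n -> word_act x T w = 0.
  move=> sz; rewrite -(word_ffun sz); set s := [ffun=> _].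
  rewrite -(@sum_subst_at _ _ s T) ?enum_uniq //.
  transitivity (ad_act x t s); last by rewrite tI ffunE.
  rewrite ffunE big_enum /=.
  by do 2!apply: eq_bigr => ? _; rewrite tT.
apply/ffunP => s; rewrite tT ffunE.
apply: (@highest_admissible n 0) => [w|w|w|]; first exact: actT.
- by rewrite mulr0 mul0r; exact: actT.
- by move=> sz; rewrite -{1}(word_ffun sz) => /t0; rewrite tT word_ffun.
- by rewrite size_map size_enum_ord.
Qed.

Lemma dim_Inv n :
  (\dim (Inv n) <= #|[set s : mindex n | admissible 0 (word s)]|)%N.
Proof.
set A := [set s | _].
pose restr (t : tensor n) : {ffun {s | s \in A} -> rat^o} := [ffun a => t (val a)].
have restr_lin : linear restr by move=> a u v; apply/ffunP => s; rewrite !ffunE.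
pose rL := GRing.isLinear.Build _ _ _ _ restr restr_lin.
pose r : {linear tensor n -> {ffun {s | s \in A} -> rat^o}} := HB.pack restr rL.
rewrite -(@limg_dim_eq _ _ _ (linfun r)).
  rewrite (leq_trans (dimvS (subvf _))) // dimvf /dim /= card_sig muln1.
  by rewrite cardsE.
apply/eqP; rewrite -subv0; apply/subvP => t; rewrite memv_cap memv_ker lfunE.
case/andP=> tI /eqP/ffunP t0; rewrite memv0; apply/eqP/Inv_admissible => // s sA.
have sA' : s \in A by rewrite inE.
by have := t0 (exist _ s sA'); rewrite !ffunE.
Qed.

(** * The word of a partition is the peak of its tensor *)

Lemma sorted_enum_ord n (B : {set 'I_n}) :
  sorted (fun i j : 'I_n => (i < j)%N) (enum B).
Proof.
rewrite /enum_mem; apply: sorted_filter; first by move=> j i k; apply: ltn_trans.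
by have := iota_ltn_sorted 0 n; rewrite -val_enum_ord sorted_map enumT.
Qed.

Lemma ltn_ord_trans n : transitive (fun i j : 'I_n => (i < j)%N).
Proof. by move=> j i k; apply: ltn_trans. Qed.

Definition charge (x : 'I_3) : int :=
  if x == sl2_e then 1 else if x == sl2_f then -1 else 0.

(** The bound for one step, from position i0 to i, of the sum by parts in
[chain_height]. *)
Lemma charge_gap (i0 i : nat) x : (i0 < i)%N ->
  i0%:Z * charge x - i%:Z * charge x <= i%:Z - i0%:Z
    ?= iff (x == sl2_f).
Proof.
move=> lt_i; have: i0%:Z < i%:Z by rewrite ltz_nat.
elim/sl2_ind: x; rewrite /charge /= ?mulr0 ?mulr1 ?mulrN1 => lt_i'; split.
- by lia.
- by apply/negbTE/eqP; lia.
- by lia.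
- by apply/negbTE/eqP; lia.
- by lia.
- by apply: (introT eqP); ring.
Qed.

Lemma c_charge x y : c_coef x y != 0 -> charge y = - charge x.
Proof.
move=> nz; apply/eqP; apply: implyP nz.
by move: x y; do 2!elim/sl2_ind; vm_compute.
Qed.

Lemma bmat_charge x y v : bmat x y v != 0 -> charge v = charge x + charge y.
Proof.
move=> nz; apply/eqP; apply: implyP nz; rewrite /bmat sum_sl2.
by move: x y v; do 3!elim/sl2_ind; vm_compute.
Qed.

(** The letters of [partition_word] on a block of size k. *)
Definition ordered_word k := sl2_f :: rcons (nseq (k - 2) sl2_h) sl2_e.

Definition height n (s : mindex n) (l : seq 'I_n) : int :=
  \sum_(i <- l) (i%:Z * charge (s i)).

(** Here [a] is the letter at [i0], or more generally the index on the edge entering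
at [i0].  Charge is conserved at each vertex, so the charge of the index on the edge
between two consecutive labels i < j is minus the sum of the later charges.  Summing by parts, the
height is the sum of (j - i) times minus the charge of this index, which is at most
j - i, with equality only for the index f.  If all indices are f, the letters must be
h until the last one, e. *)
Lemma chain_height n (s : mindex n) a (i0 : 'I_n) l :
  path (fun i j : 'I_n => (i < j)%N) i0 l -> chain_coef a [seq s i | i <- l] != 0 ->
  [/\ charge a + \sum_(i <- l) charge (s i) = 0,
      height s l + i0%:Z * charge a <= (last i0 l)%:Z - i0%:Z
    & height s l + i0%:Z * charge a = (last i0 l)%:Z - i0%:Z ->
      a = sl2_f /\ [seq s i | i <- l] = rcons (nseq (size l).-1 sl2_h) sl2_e].
Proof.
rewrite /height.
elim: l i0 a => [|i l IHl] i0 a; first by rewrite eqxx.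
case: l IHl => [_|j l IHl].
  rewrite /= andbT => lt_i /c_charge ca; rewrite !big_seq1 ca addrN mulrN addrC.
  have [le_gap eq_gap] := charge_gap a lt_i; split=> // /eqP.
  rewrite eq_gap => /eqP af; split=> //.
  by move: ca; rewrite af; elim/sl2_ind: (s i).
case/andP=> lt_i pl; have [le_gap eq_gap] := charge_gap a lt_i.
rewrite -[_ != 0]/(\sum_v bmat a (s i) v * chain_coef v [seq s k | k <- j :: l] != 0) => nz.
have [v /andP[/bmat_charge bv cv]|none] :=
    pickP (fun v => (bmat a (s i) v != 0) && (chain_coef v [seq s k | k <- j :: l] != 0)); last first.
  case/eqP: nz; apply: big1 => v _; apply/eqP.
  by rewrite mulf_eq0 -[_ || _]negbK negb_or none.
have [sum0 le_h eq_h] := IHl i v pl cv.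
rewrite ![\sum_(k <- i :: _) _]big_cons /=; move: sum0 le_h eq_h.
set h := \sum_(k <- _) _ * _; set c := \sum_(k <- _) _; set e := (last j l)%:Z.
rewrite bv mulrDr => sum0 le_h eq_h.
split; [lia | lia | move=> eq_e].
have /eqP : i0%:Z * charge a - i%:Z * charge a = i%:Z - i0%:Z by lia.
rewrite eq_gap => /eqP af; split=> //.
have [vf eq_l] : v = sl2_f /\ [seq s k | k <- j :: l] = rcons (nseq (size l) sl2_h) sl2_e.
  by apply: eq_h; lia.
rewrite -[LHS]/(s i :: [seq s k | k <- j :: l]) eq_l.
suff -> : s i = sl2_h by [].
by move: bv; rewrite vf af; elim/sl2_ind: (s i).
Qed.

Lemma linear_height n (s : mindex n) (i0 : 'I_n) l : (0 < size l)%N ->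
  sorted (fun i j : 'I_n => (i < j)%N) (i0 :: l) ->
  linear_coef [seq s i | i <- i0 :: l] != 0 ->
  height s (i0 :: l) <= (last i0 l)%:Z - i0%:Z
    ?= iff ([seq s i | i <- i0 :: l] == ordered_word (size l).+1).
Proof.
move=> l_gt0 /= pl nz; have [_ le_h eq_h] := chain_height pl nz.
rewrite /height big_cons -/(height s l) addrC; split; first exact: le_h.
apply/eqP/eqP => [/eq_h[-> ->]|].
  by rewrite /ordered_word subSS subn1.
case/lastP: {eq_h le_h nz pl} l l_gt0 => // l j _.
rewrite /ordered_word size_rcons !subSS subn0 map_rcons.
case=> -> /rcons_inj[sl sj]; rewrite last_rcons mulrN1; congr (_ - _).
rewrite /height -cats1 big_cat big_seq1 /= sj mulr1 big1_seq ?add0r // => k /= kl.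
suff -> : s k = sl2_h by rewrite mulr0.
by have := map_f s kl; rewrite sl => /nseqP[].
Qed.

Lemma ordered_word_coef k : (1 < k)%N -> linear_coef (ordered_word k) = 1.
Proof.
case: k => [|[|k]] // _; rewrite /ordered_word /= !subSS subn0.
have bf v : bmat sl2_f sl2_h v = (v == sl2_f)%:R.
  by rewrite /bmat sum_sl2; move: v; elim/sl2_ind; apply/eqP; vm_compute.
elim: k => [|k IHk]; first by apply/eqP; vm_compute.
transitivity (\sum_v bmat sl2_f sl2_h v * chain_coef v (rcons (nseq k sl2_h) sl2_e)).
  by case: (k).
by rewrite sum_sl2 !bf /= !mul0r !add0r mul1r.
Qed.

Definition partition_word n (P : {set {set 'I_n}}) : mindex n :=
  [ffun i => if [forall j in pblock P i, (i <= j)%N] then sl2_f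
             else if [forall j in pblock P i, (j <= i)%N] then sl2_e else sl2_h].

Lemma partition_word_block n (P : {set {set 'I_n}}) B :
  trivIset P -> B \in P -> (1 < #|B|)%N ->
  [seq partition_word P i | i <- enum B] = ordered_word #|B|.
Proof.
move=> tiP BP; rewrite cardE.
have B_eq i : (i \in enum B) = (i \in B) by rewrite mem_enum.
have := sorted_enum_ord B; case: (enum B) B_eq => [|i0 l] // B_eq pl l_gt0.
case/lastP: l => [|l i1] // in B_eq pl l_gt0 *.
have {}B_eq i : i \in B = [|| i == i0, i == i1 | i \in l].
  by rewrite -B_eq inE mem_rcons inE.
move: pl; rewrite /ordered_word /= size_rcons !subSS subn0.
rewrite -[path _ _ _]/(sorted _ (i0 :: rcons l i1)).
rewrite sorted_pairwise; last exact: ltn_ord_trans.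
rewrite /= all_rcons pairwise_rcons => /andP[/andP[lt01 /allP lt0] /andP[/allP lt1 _]].
have pB i : i \in B -> pblock P i = B by move=> iB; apply: def_pblock.
have i0B : i0 \in B by rewrite B_eq eqxx.
have i1B : i1 \in B by rewrite B_eq eqxx orbT.
have min0 : [forall j in B, (i0 <= j)%N].
  by apply/forall_inP => j; rewrite B_eq => /or3P[/eqP->|/eqP->|/lt0/ltnW] //; exact: ltnW.
have nmin i : i \in B -> (i0 < i)%N -> [forall j in B, (i <= j)%N] = false.
  by move=> iB lt; apply/negbTE/forall_inP => /(_ i0 i0B); rewrite leqNgt lt.
have max1 : [forall j in B, (j <= i1)%N].
  by apply/forall_inP => j; rewrite B_eq => /or3P[/eqP->|/eqP->|/lt1/ltnW] //; exact: ltnW.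
rewrite map_rcons; congr (_ :: rcons _ _).
- by rewrite ffunE pB // min0.
- rewrite -(size_map (partition_word P) l); apply/all_pred1P/allP => x /mapP[i il ->{x}] /=.
  have iB : i \in B by rewrite B_eq il !orbT.
  rewrite ffunE pB // nmin ?lt0 // ifF //.
  by apply/negbTE/forall_inP => /(_ i1 i1B); rewrite leqNgt lt1.
- by rewrite ffunE pB // nmin // max1.
Qed.

(** The word of P is the peak of its tensor: heights add up over the blocks, to which
[linear_height] applies. *)
Lemma word_height n (P : {set {set 'I_n}}) (s : mindex n) :
  partition P [set: 'I_n] -> (forall B, B \in P -> (1 < #|B|)%N) ->
  partition_tensor P s != 0 ->
  height s (enum 'I_n) <= height (partition_word P) (enum 'I_n)
    ?= iff (s == partition_word P).
Proof.
move=> /and3P[/eqP covP tiP _] P2; rewrite ffunE => /prodf_neq0 nz.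
have heightE u : height u (enum 'I_n) = \sum_(B in P) height u (enum B).
  rewrite /height big_enum /= (eq_bigl (mem (cover P))) ?big_trivIset //=; last first.
    by move=> i; rewrite covP; exact: esym (in_setT i).
  by apply: eq_bigr => B _; rewrite big_enum.
rewrite !heightE.
have step B : B \in P -> height s (enum B) <= height (partition_word P) (enum B)
    ?= iff ([seq s i | i <- enum B] == [seq partition_word P i | i <- enum B]).
  move=> BP; have := nz B BP; have := ordered_word_coef (P2 B BP).
  have := partition_word_block tiP BP (P2 B BP).
  have := sorted_enum_ord B; have := P2 B BP; rewrite cardE.
  case: (enum B) => [|i0 l] // l_gt0 so pw ow nzB; rewrite pw.
  have nz_pw : linear_coef [seq partition_word P i | i <- i0 :: l] != 0.
    by rewrite pw ow oner_eq0.
  have [_] := linear_height l_gt0 so nz_pw; rewrite pw eqxx => /eqP ->.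
  exact: linear_height l_gt0 so nzB.
have [le_h eq_h] := leif_sum step; split=> //; rewrite eq_h {eq_h le_h}.
apply/forall_inP/eqP => [eqB|-> //].
apply/ffunP => i; have iP : i \in cover P by rewrite covP inE.
have /eqP/eq_in_map -> // := eqB _ (pblock_mem iP).
by rewrite mem_enum mem_pblock.
Qed.

Lemma partition_tensor_word n (P : {set {set 'I_n}}) :
  trivIset P -> (forall B, B \in P -> (1 < #|B|)%N) ->
  partition_tensor P (partition_word P) = 1.
Proof.
move=> tiP P2; rewrite ffunE big1 // => B BP.
by rewrite partition_word_block ?ordered_word_coef ?P2.
Qed.

(** In a linear relation, take a P with nonzero coefficient and highest word: no
other tensor of the relation is nonzero at this word. *)
Lemma free_partition_tensor n (Q : {set {set {set 'I_n}}}) :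
  (forall P, P \in Q -> partition P [set: 'I_n]) ->
  (forall P, P \in Q -> forall B, B \in P -> (1 < #|B|)%N) ->
  {in Q &, injective (@partition_word n)} ->
  free [seq partition_tensor P | P <- enum Q].
Proof.
move=> Qpart Q2 Qinj; rewrite -[X in free X]in_tupleE.
set X := in_tuple _; have szX : size X = #|Q| by rewrite size_map -cardE.
apply/freeP => a sum0.
pose part i := nth set0 (enum Q) i.
have ltQ (i : 'I_(size X)) : (i < size (enum Q))%N by rewrite -cardE -szX.
have partQ (i : 'I_(size X)) : part i \in Q.
  by rewrite -mem_enum mem_nth.
have partX (i : 'I_(size X)) : X`_i = partition_tensor (part i).
  by rewrite (nth_map set0) // ltQ.
case: (pickP (fun i => a i != 0)) => [i0 ai0|a0]; last first.
  by move=> i; apply/eqP; rewrite -[_ == _]negbK a0.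
have [i ai max_i] := @Order.TotalTheory.arg_maxP _ int _ i0 (fun i => a i != 0)
    (fun i => height (partition_word (part i)) (enum 'I_n)) ai0.
have /ffunP/(_ (partition_word (part i))) := sum0.
rewrite sum_ffunE (bigD1 i) //= big1 ?addr0 => [|j ji].
  rewrite ffunE partX partition_tensor_word; last exact: Q2.
    by rewrite /GRing.scale /= mulr1 ffunE => /eqP; rewrite (negbTE ai).
  by have /and3P[] := Qpart _ (partQ i).
rewrite ffunE partX; apply/eqP; apply: contraNT ji => nz.
have nz_a : a j != 0 by apply: contraNneq nz => ->; rewrite scale0r.
have nz_t : partition_tensor (part j) (partition_word (part i)) != 0.
  by apply: contraNneq nz => ->; rewrite scaler0.
have [le_h eq_h] := word_height (Qpart _ (partQ j)) (Q2 _ (partQ j)) nz_t.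
have : height (partition_word (part i)) (enum 'I_n)
       == height (partition_word (part j)) (enum 'I_n).
  by rewrite eq_le le_h; exact: max_i.
rewrite eq_h => /eqP/(Qinj _ _ (partQ i) (partQ j)) eq_ij; apply/eqP/val_inj/eqP.
rewrite -(nth_uniq set0 (ltQ j) (ltQ i)) ?enum_uniq //; apply/eqP.
exact: esym eq_ij.
Qed.

(** * Noncrossing partitions from admissible words *)

(** The combinatorial counterpart of [riordan_partition]. *)
Definition riordan_set n : {set {set {set 'I_n}}} :=
  [set P | [&& partition P [set: 'I_n], [forall B in P, 1 < #|B|]%N
    & [forall B in P, forall C in P, (B != C) ==>
       [forall a in B, forall b in C, forall c in B, forall d in C,
          ~~ [&& a < b, b < c & c < d]%N]]]].

Lemma riordan_setP n (P : {set {set 'I_n}}) :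
  reflect [/\ partition P [set: 'I_n], forall B, B \in P -> (1 < #|B|)%N
    & forall B C (a b c d : 'I_n), B \in P -> C \in P -> B != C ->
        a \in B -> b \in C -> c \in B -> d \in C ->
        (a < b)%N -> (b < c)%N -> (c < d)%N -> False]
    (P \in riordan_set n).
Proof.
rewrite inE; apply: (iffP and3P) => -[partP P2 P_nc]; split=> //.
- exact/forall_inP.
- move=> B C a b c d BP CP BC aB bC cB dC ab bc cd.
  move/forall_inP/(_ B BP)/forall_inP/(_ C CP)/implyP/(_ BC): P_nc.
  move/forall_inP/(_ a aB)/forall_inP/(_ b bC)/forall_inP/(_ c cB).
  by move/forall_inP/(_ d dC); rewrite ab bc cd.
- exact/forall_inP.
apply/forall_inP => B BP; apply/forall_inP => C CP; apply/implyP => BC.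
apply/forall_inP => a aB; apply/forall_inP => b bC.
apply/forall_inP => c cB; apply/forall_inP => d dC.
by apply/negP => /and3P[]; apply: P_nc BC aB bC cB dC.
Qed.

Section Levels.
Variables (n : nat) (w : mindex n).
Implicit Types i j : 'I_n.

Definition level (k : nat) : int := - \sum_(i < n | (i < k)%N) charge (w i).

Lemma level0 : level 0 = 0.
Proof. by rewrite /level big_pred0. Qed.

Lemma levelS i : level i.+1 = level i - charge (w i).
Proof.
rewrite /level (bigD1 i) //= opprD addrC; congr (- _ - _).
by apply: eq_bigl => j; rewrite ltnS ltn_neqAle andbC.
Qed.

(** The level at which the arch of position i runs: the level after an up step,
before a down step, and the level of a level step. *)
Definition depth i : int := Num.max (level i) (level i.+1).

Lemma depth_not_e i : w i != sl2_e -> depth i = level i.+1.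
Proof.
rewrite /depth levelS => wi; apply/max_idPr.
by elim/sl2_ind: (w i) wi => //= _; rewrite /charge /=; lia.
Qed.

Lemma depth_not_f i : w i != sl2_f -> depth i = level i.
Proof.
rewrite /depth levelS => wi; apply/max_idPl.
by elim/sl2_ind: (w i) wi => //= _; rewrite /charge /=; lia.
Qed.

Lemma level_f i : w i = sl2_f -> level i.+1 = level i + 1.
Proof. by rewrite levelS => ->. Qed.

Lemma level_e i : w i = sl2_e -> level i.+1 = level i - 1.
Proof. by rewrite levelS => ->. Qed.

(** Positions are linked if they have the same depth and the path stays at or above
it between them.  Levels are attached to the points between consecutive positions, the
level [k] being read just before position k; hence the range from min i j excluded to
max i j included. *)
Definition linked : rel 'I_n := fun i j =>
  (depth i == depth j) &&
  [forall k : 'I_n, (minn i j < k <= maxn i j)%N ==> (depth i <= level k)].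

Lemma linkedP i j : (i <= j)%N ->
  reflect (depth i = depth j /\
           forall k : 'I_n, (i < k <= j)%N -> depth i <= level k) (linked i j).
Proof.
move=> le_ij; rewrite /linked (minn_idPl le_ij) (maxn_idPr le_ij).
apply: (iffP andP) => [[/eqP eq_d lev]|[eq_d lev]]; split=> //.
- by move=> k; move/forallP/(_ k)/implyP: lev.
- exact/eqP.
by apply/forallP => k; apply/implyP => /lev.
Qed.

Lemma linked_sym i j : linked i j = linked j i.
Proof.
by rewrite /linked minnC maxnC eq_sym; case: eqP => //= ->.
Qed.

Lemma linked_equiv : {in [set: 'I_n] & &, equivalence_rel linked}.
Proof.
have linked_trans i j k : linked i j -> linked j k -> linked i k.
  rewrite /linked => /andP[/eqP dij /forallP lij] /andP[/eqP djk /forallP ljk].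
  rewrite dij djk eqxx; apply/forallP => m; apply/implyP => hm.
  case: (boolP (minn i j < m <= maxn i j)%N) => [hij|nij].
    by rewrite -djk -dij; exact: (implyP (lij m)).
  rewrite -djk; apply: (implyP (ljk m)).
  by clear -hm nij; lia.
move=> i j k _ _ _; split=> [|lij].
  apply/linkedP => //; split=> // m /andP[im mi].
  by have := leq_trans im mi; rewrite ltnn.
by apply/idP/idP; apply: linked_trans; rewrite // linked_sym.
Qed.

(** Just before an up step the path is below the depth of that step, so nothing to its
left is linked to it. *)
Lemma linked_f_min i j : w i = sl2_f -> linked i j -> (i <= j)%N.
Proof.
move=> wi; rewrite linked_sym leqNgt => lij; apply/negP => lt_ji.
have [dji lev] := linkedP (ltnW lt_ji) lij.
have := lev i; rewrite lt_ji leqnn dji depth_not_e ?wi // level_f // => /(_ isT).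
by lia.
Qed.

Lemma linked_e_max i j : w i = sl2_e -> linked i j -> (j <= i)%N.
Proof.
move=> wi lij; rewrite leqNgt; apply/negP => lt_ij.
have lt_n : (i.+1 < n)%N by apply: leq_ltn_trans (ltn_ord j).
have [_ lev] := linkedP (ltnW lt_ij) lij.
have := lev (Ordinal lt_n); rewrite /= ltnSn lt_ij => /(_ isT).
by rewrite depth_not_f ?wi // level_e //; lia.
Qed.

Definition linked_partition := equivalence_partition linked [set: 'I_n].

Lemma linked_partitionP : partition linked_partition [set: 'I_n].
Proof. exact/equivalence_partitionP/linked_equiv. Qed.

Lemma mem_pblock_linked i j : (j \in pblock linked_partition i) = linked i j.
Proof. by rewrite pblock_equivalence_partition ?inE //; exact: linked_equiv. Qed.

(** If a < b < c < d, then b lies under the arch from a to c and is at least as deep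
as a, and c lies under the arch from b to d and is at least as deep as b; so all
depths agree. *)
Lemma linked_noncrossing (a b c d : 'I_n) : linked a c -> linked b d ->
  (a < b)%N -> (b < c)%N -> (c < d)%N -> linked a b.
Proof.
move=> lac lbd ab bc cd.
have [dac lev_ac] := linkedP (ltnW (ltn_trans ab bc)) lac.
have [dbd lev_bd] := linkedP (ltnW (ltn_trans bc cd)) lbd.
have le_ab : depth a <= depth b.
  by rewrite le_max lev_ac // ab ltnW.
have le_ba : depth b <= depth a.
  by rewrite dac le_max lev_bd // bc ltnW.
apply/(linkedP (ltnW ab)); split=> [|k /andP[ak kb]].
  by apply/eqP; rewrite eq_le le_ab.
by apply: lev_ac; rewrite ak (leq_trans kb) // ltnW.
Qed.

Hypothesis w_adm : admissible 0 (word w).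

Lemma admissible_drop k : (k <= n)%N ->
  exists2 m : nat, m%:Z = level k & admissible m (drop k (word w)).
Proof.
have szw : size (word w) = n by rewrite size_map size_enum_ord.
elim: k => [_|k IHk lt_kn]; first by exists 0%N; rewrite ?level0 ?drop0.
have [m lev] := IHk (ltnW lt_kn).
have nthw : nth sl2_h (word w) k = w (Ordinal lt_kn).
  rewrite (nth_map (Ordinal lt_kn)) ?size_enum_ord //; congr (w _).
  by apply/val_inj; rewrite /= nth_enum_ord.
rewrite (drop_nth sl2_h) ?szw // nthw /=.
have := levelS (Ordinal lt_kn); rewrite /= -lev => ->.
case: ifP => [/eqP-> adm|wf /andP[m_gt0]]; first by exists m.+1 => //; rewrite -addn1 PoszD.
case: ifP => [/eqP-> adm|wh adm]; first by exists m => //; rewrite subr0.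
exists m.-1 => //; elim/sl2_ind: (w _) wf wh => // _ _.
by rewrite -[charge _]/1; lia.
Qed.

Lemma level_ge0 k : (k <= n)%N -> 0 <= level k.
Proof. by case/admissible_drop => m <-. Qed.

Lemma level_end : level n = 0.
Proof.
have [m <-] := admissible_drop (leqnn n).
rewrite drop_oversize; last by rewrite size_map size_enum_ord.
by move=> /eqP->.
Qed.

Lemma level_not_f i : w i != sl2_f -> 0 < level i.
Proof.
move=> wi; have [m <-] := admissible_drop (ltnW (ltn_ord i)).
have szw : size (word w) = n by rewrite size_map size_enum_ord.
rewrite (drop_nth sl2_h) ?szw // (nth_map i) ?size_enum_ord // nth_ord_enum /=.
by rewrite (negbTE wi) => /andP[].
Qed.

(** The last position before i where the path is lower than i is an up step, and it is
linked to i. *)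
Lemma linked_before i : w i != sl2_f -> exists2 j : 'I_n, (j < i)%N & linked i j.
Proof.
move=> wi; have lev_gt0 := level_not_f wi.
have i_gt0 : (0 < i)%N by case: (posnP i) lev_gt0 => [->|//]; rewrite level0.
have n_gt0 : (0 < n)%N by apply: leq_trans (ltn_ord i).
pose low j := (j < i)%N && (level j < level i).
have low0 : low (Ordinal n_gt0) by rewrite /low /= i_gt0 level0.
have [j /andP[lt_ji lev_j] max_j] := arg_maxnP (fun j : 'I_n => val j) low0.
have lev (k : 'I_n) : (j < k <= i)%N -> level i <= level k.
  rewrite [(k <= i)%N]leq_eqVlt => /andP[jk /orP[/eqP/val_inj-> //|ki]].
  rewrite leNgt; apply/negP => lk; have : (k <= j)%N by apply: max_j; rewrite /low ki lk.
  by rewrite leqNgt jk.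
have levS : level i <= level j.+1.
  have lt_n : (j.+1 < n)%N by apply: leq_ltn_trans (ltn_ord i).
  by apply: (lev (Ordinal lt_n)); rewrite /= ltnSn.
have wj : w j = sl2_f.
  by move: levS; rewrite levelS; elim/sl2_ind: (w j) => //; rewrite /charge /=; lia.
have dj : depth j = level i.
  by rewrite depth_not_e ?wj //; move: levS; rewrite level_f //; lia.
exists j; rewrite // linked_sym; apply/(linkedP (ltnW lt_ji)).
by rewrite dj depth_not_f.
Qed.

(** The first position after i from which the path goes lower is a down step, and it
is linked to i. *)
Lemma linked_after i : w i != sl2_e -> exists2 j : 'I_n, (i < j)%N & linked i j.
Proof.
move=> wi; have lev_gt0 : 0 < level i.+1.
  have := level_ge0 (ltnW (ltn_ord i)); have := @level_not_f i.
  by rewrite levelS; elim/sl2_ind: (w i) wi => //= _; rewrite /charge /=; lia.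
have lt_n : (i.+1 < n)%N.
  by rewrite ltn_neqAle ltn_ord andbT; apply: contraTneq lev_gt0 => ->; rewrite level_end.
pose low (j : 'I_n) := (i < j)%N && (level j.+1 < level i.+1).
have n_gt0 : (0 < n)%N by apply: leq_trans (ltn_ord i).
have lt_n1 : (n.-1 < n)%N by rewrite prednK.
have low1 : low (Ordinal lt_n1) by rewrite /low /= prednK // level_end lev_gt0 andbT; lia.
have [j /andP[lt_ij lev_j] min_j] := arg_minnP (fun j : 'I_n => val j) low1.
have lev (k : 'I_n) : (i < k <= j)%N -> level i.+1 <= level k.
  case: k => [[|k] lt_k] //= /andP[]; rewrite ltnS leq_eqVlt => /orP[/eqP<- //|ik] kj.
  rewrite leNgt; apply/negP => lk; have : (j <= k)%N.
    by apply: (min_j (Ordinal (ltnW lt_k))); rewrite /low /= ik.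
  by rewrite leqNgt kj.
have levj : level i.+1 <= level j by apply: lev; rewrite lt_ij /=.
have wj : w j = sl2_e.
  by move: lev_j; rewrite levelS; elim/sl2_ind: (w j) => //; rewrite /charge /=; lia.
have dj : depth j = level i.+1.
  by rewrite depth_not_f ?wj //; move: lev_j; rewrite level_e //; lia.
exists j => //; apply/(linkedP (ltnW lt_ij)).
by rewrite dj depth_not_e.
Qed.

Lemma linked_riordan : linked_partition \in riordan_set n.
Proof.
have partP := linked_partitionP; have /and3P[/eqP covP tiP P0] := partP.
apply/riordan_setP; split=> // [B BP|B C a b c d BP CP BC aB bC cB dC ab bc cd].
  have /set0Pn[i iB] : B != set0 by apply: contraNneq P0 => <-.
  have pBi := def_pblock tiP BP iB.
  have [j ij lij] : exists2 j, i != j & linked i j.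
    case: (eqVneq (w i) sl2_f) => [wi|/linked_before[j lt_ji lij]].
      have [|j lt_ij lij] := @linked_after i; first by rewrite wi.
      by exists j => //; rewrite neq_ltn lt_ij.
    by exists j => //; rewrite neq_ltn lt_ji orbT.
  have /subset_leq_card : [set i; j] \subset B.
    by rewrite subUset !sub1set iB -pBi mem_pblock_linked.
  by rewrite cards2 ij.
have pb (D : {set 'I_n}) i j : D \in linked_partition -> i \in D -> j \in D -> linked i j.
  by move=> DP iD jD; rewrite -mem_pblock_linked (def_pblock tiP DP iD).
have := linked_noncrossing (pb _ _ _ BP aB cB) (pb _ _ _ CP bC dC) ab bc cd.
rewrite -mem_pblock_linked (def_pblock tiP BP aB) => bB.
by move/trivIsetP/(_ B C BP CP BC)/disjoint_setI0/setP/(_ b): tiP; rewrite !inE bB bC.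
Qed.

Lemma linked_partition_word : partition_word linked_partition = w.
Proof.
apply/ffunP => i; rewrite ffunE.
have min_i : [forall j in pblock linked_partition i, (i <= j)%N] = (w i == sl2_f).
  apply/forall_inP/eqP => [min_i|wi j].
    apply: contraTeq isT => /linked_before[j lt_ji]; rewrite -mem_pblock_linked.
    by move/min_i; rewrite leqNgt lt_ji.
  by rewrite mem_pblock_linked; exact: linked_f_min.
have max_i : [forall j in pblock linked_partition i, (j <= i)%N] = (w i == sl2_e).
  apply/forall_inP/eqP => [max_i|wi j].
    apply: contraTeq isT => /linked_after[j lt_ij]; rewrite -mem_pblock_linked.
    by move/max_i; rewrite leqNgt lt_ij.
  by rewrite mem_pblock_linked; exact: linked_e_max.
by rewrite min_i max_i; elim/sl2_ind: (w i).
Qed.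

End Levels.

Lemma card_admissible n :
  (#|[set s : mindex n | admissible 0 (word s)]| <= #|riordan_set n|)%N.
Proof.
rewrite -(card_in_imset (f := @linked_partition n)) => [|s t]; last first.
  rewrite !inE => /linked_partition_word eq_s /linked_partition_word eq_t st.
  by rewrite -eq_s st.
apply/subset_leq_card/subsetP => P /imsetP[s]; rewrite inE => s_adm ->.
exact: linked_riordan.
Qed.

(** * A noncrossing partition is determined by its word *)

Section RiordanWord.
Variables (n : nat) (P : {set {set 'I_n}}).
Hypothesis riordanP : P \in riordan_set n.
Let w := partition_word P.

Let partP : partition P [set: 'I_n].
Proof. by have /riordan_setP[] := riordanP. Qed.

Let tiP : trivIset P.
Proof. by have /and3P[] := partP. Qed.

Let pbP i : pblock P i \in P /\ i \in pblock P i.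
Proof.
have /and3P[/eqP covP _ _] := partP.
have iP : i \in cover P by rewrite covP inE.
by rewrite pblock_mem // mem_pblock.
Qed.

Let disjP B C i : B \in P -> C \in P -> B != C -> i \in B -> i \in C -> False.
Proof.
move=> BP CP BC iB iC; have /trivIsetP/(_ B C BP CP BC) := tiP.
by move/disjoint_setI0/setP/(_ i); rewrite !inE iB iC.
Qed.

Let noncross B C (a b c d : 'I_n) : B \in P -> C \in P -> B != C ->
  a \in B -> b \in C -> c \in B -> d \in C ->
  (a < b)%N -> (b < c)%N -> (c < d)%N -> False.
Proof. by have /riordan_setP[_ _] := riordanP; apply. Qed.

Lemma block_shape B : B \in P -> exists i0 l i1,
  [/\ enum B = i0 :: rcons l i1, w i0 = sl2_f, all (fun i => w i == sl2_h) l
    & w i1 = sl2_e].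
Proof.
have /riordan_setP[_ P2 _] := riordanP => BP.
have := partition_word_block tiP BP (P2 B BP); rewrite -/w.
case: (enum B) => [|i0 l] // [w0]; case/lastP: l => [|l i1]; first by case: (nseq _ _).
rewrite map_rcons => /rcons_inj[wl w1]; exists i0, l, i1; split=> //.
apply/allP => i /(map_f w); rewrite wl => /nseqP[-> _]; exact: eqxx.
Qed.

Lemma block_ends B : B \in P -> exists i0 i1 : 'I_n,
  [/\ [/\ i0 \in B, i1 \in B & (i0 < i1)%N],
      forall i, i \in B -> (i0 <= i <= i1)%N
    & [/\ w i0 = sl2_f, w i1 = sl2_e
        & forall i, i \in B -> i != i0 -> i != i1 -> w i = sl2_h]].
Proof.
move=> BP; have [i0 [l [i1 [eB w0 /allP wl w1]]]] := block_shape BP.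
have B_eq i : (i \in B) = [|| i == i0, i == i1 | i \in l].
  by rewrite -mem_enum eB inE mem_rcons inE.
have := sorted_enum_ord B; rewrite eB sorted_pairwise; last exact: ltn_ord_trans.
rewrite /= all_rcons pairwise_rcons => /andP[/andP[lt01 /allP lt0] /andP[/allP lt1 _]].
exists i0, i1; split=> [|i|]; first by rewrite !B_eq !eqxx orbT.
  rewrite B_eq => /or3P[/eqP->|/eqP->|il].
  - by rewrite leqnn ltnW.
  - by rewrite leqnn ltnW.
  - by rewrite (ltnW (lt0 i il)) (ltnW (lt1 i il)).
split=> // i; rewrite B_eq => /or3P[->|->|/wl/eqP] //.
Qed.

(** The block is open between the positions k - 1 and k: it has elements on both
sides. *)
Definition open_at (B : {set 'I_n}) (k : nat) : bool :=
  [exists a in B, (a < k)%N] && [exists b in B, (k <= b)%N].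

Lemma open_atP (B : {set 'I_n}) k :
  reflect (exists a b : 'I_n, [/\ a \in B, b \in B & (a < k <= b)%N]) (open_at B k).
Proof.
apply: (iffP andP) => [[/exists_inP[a aB ak] /exists_inP[b bB kb]]|].
  by exists a, b; rewrite ak.
by case=> a [b [aB bB /andP[ak kb]]]; split; apply/exists_inP; [exists a|exists b].
Qed.

(** The level of the word of P counts the open blocks, as each block starts with f and
ends with e. *)
Lemma level_open k : level w k = \sum_(B in P) (open_at B k)%:Z.
Proof.
have /and3P[/eqP covP _ _] := partP.
rewrite /level -sumrN big_mkcond /= (eq_bigl (mem (cover P))) ?big_trivIset //=; last first.
  by move=> i; rewrite covP; exact: esym (in_setT i).
apply: eq_bigr => B BP; have [i0 [i1 [[i0B i1B lt01] bnd [w0 w1 wh]]]] := block_ends BP.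
have i10 : i1 != i0 by rewrite -(inj_eq val_inj) gtn_eqF.
rewrite (bigD1 i0) //= (bigD1 i1) /=; last by rewrite i1B.
rewrite big1 ?addr0 => [|i /andP[/andP[iB ii0] ii1]]; last first.
  by rewrite wh // oppr0 if_same.
rewrite w0 w1; have -> : open_at B k = (i0 < k <= i1)%N.
  apply/open_atP/andP => [[a [b [aB bB /andP[ak kb]]]]|[ak kb]].
    have /andP[le0 _] := bnd a aB; have /andP[_ le1] := bnd b bB.
    by rewrite (leq_ltn_trans le0) // (leq_trans kb).
  by exists i0, i1; rewrite ak.
rewrite /charge /=; clear -lt01; case: (ltnP i1 k) => lt1; case: (ltnP i0 k) => lt0 //=.
by have := leq_trans lt01 (leq_trans (ltnW lt1) lt0); rewrite ltnn.
Qed.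

(** At an element of B, the depth counts B itself and the other blocks open there. *)
Lemma depth_open B i : B \in P -> i \in B ->
  depth w i = 1 + \sum_(C in P | C != B) (open_at C i)%:Z.
Proof.
move=> BP iB; have [i0 [i1 [[i0B i1B lt01] bnd [w0 w1 wh]]]] := block_ends BP.
have openS C : C \in P -> C != B -> open_at C i.+1 = open_at C i.
  move=> CP CB; apply/open_atP/open_atP => -[a [b [aC bC /andP[ak kb]]]];
    exists a, b; split=> //.
    rewrite (ltnW kb) andbT ltn_neqAle (ak : (a <= i)%N) andbT.
    by apply/negP => /eqP/val_inj ai; rewrite ai in aC; exact: (disjP CP BP CB aC iB).
  rewrite ltnW //= ltn_neqAle kb andbT; apply/negP => /eqP/val_inj ib.
  by rewrite -ib in bC; exact: (disjP CP BP CB bC iB).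
case: (eqVneq (w i) sl2_f) => wi.
  rewrite depth_not_e ?wi // level_open (bigD1 B) //=; congr (_ + _).
    suff -> : open_at B i.+1 by [].
    apply/open_atP; exists i, i1; rewrite iB i1B ltnSn; split=> //=.
    have /andP[_] := bnd i iB; rewrite leq_eqVlt => /orP[/eqP/val_inj ii1|//].
    by move: wi; rewrite ii1 w1.
  by apply: eq_bigr => C /andP[CP CB]; rewrite openS.
rewrite depth_not_f // level_open (bigD1 B) //=; congr (_ + _).
suff -> : open_at B i by [].
apply/open_atP; exists i0, i; rewrite i0B iB leqnn; split=> //=.
have /andP[+ _] := bnd i iB; rewrite leq_eqVlt => /orP[/eqP/val_inj ii0|->//].
by case/eqP: wi; rewrite -ii0 w0.
Qed.

(** A block C that is open at i but closes before k <= j, with i and j in B, crosses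
B. *)
Lemma open_block B C (i j k : 'I_n) : B \in P -> C \in P -> C != B ->
  i \in B -> j \in B -> (i < k <= j)%N -> open_at C i -> open_at C k.
Proof.
move=> BP CP CB iB jB /andP[ik kj] /open_atP[a [b [aC bC /andP[ai ib]]]].
apply/open_atP; exists a, b; split=> //; rewrite (ltn_trans ai) //=.
rewrite leqNgt; apply/negP => lt_bk.
apply: (noncross CP BP CB aC iB bC jB) => //; last exact: leq_trans kj.
rewrite ltn_neqAle ib andbT; apply/negP => /eqP/val_inj eq_ib.
by rewrite -eq_ib in bC; exact: (disjP CP BP CB bC iB).
Qed.

Lemma open_block_eq B C (i j : 'I_n) : B \in P -> C \in P -> C != B ->
  i \in B -> j \in B -> (i < j)%N -> open_at C i = open_at C j.
Proof.
move=> BP CP CB iB jB ij; apply/idP/idP.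
  by apply: open_block BP CP CB iB jB _; rewrite ij /=.
case/open_atP=> a [b [aC bC /andP[aj jb]]]; apply/open_atP; exists a, b; split=> //.
rewrite (ltnW (leq_trans ij jb)) andbT ltnNge; apply/negP => le_ia.
have BC : B != C by rewrite eq_sym.
apply: (noncross BP CP BC iB aC jB bC) => //.
  rewrite ltn_neqAle le_ia andbT; apply/negP => /eqP/val_inj ia.
  by rewrite -ia in aC; exact: (disjP BP CP BC iB aC).
rewrite ltn_neqAle jb andbT; apply/negP => /eqP/val_inj jb'.
by rewrite -jb' in bC; exact: (disjP BP CP BC jB bC).
Qed.

Lemma block_linked B (i j : 'I_n) : B \in P -> i \in B -> j \in B -> linked w i j.
Proof.
move=> BP; wlog le_ij: i j / (i <= j)%N => [IH iB jB|].
  case: (leqP i j) => [ij|/ltnW ji]; first exact: IH.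
  by rewrite linked_sym; exact: IH.
move: le_ij; rewrite leq_eqVlt => /orP[/eqP/val_inj-> jB _|ij iB jB].
  by have [] := @linked_equiv n w j j j; rewrite ?inE.
apply/(linkedP _ (ltnW ij)); rewrite !(depth_open BP) //; split=> [|k ikj].
  congr (_ + _); apply: eq_bigr => C /andP[CP CB].
  by rewrite (open_block_eq BP CP CB iB jB ij).
rewrite level_open [X in _ <= X](bigD1 B) //=; apply: lerD.
  suff -> : open_at B k by [].
  by apply/open_atP; exists i, j.
apply: ler_sum => C /andP[CP CB]; case: (boolP (open_at C i)) => // open_i.
by rewrite (open_block BP CP CB iB jB ikj open_i).
Qed.

(** P is recovered from its word.  Elements of a block are linked by [block_linked].
Conversely a linked class contains only one letter f, by [linked_f_min], whereas each
block contains one; so it contains only one block. *)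
Lemma pblock_riordan (i j : 'I_n) : (j \in pblock P i) = linked w i j.
Proof.
have [iP iB] := pbP i; have [jP jB] := pbP j.
apply/idP/idP => [jBi|lij]; first exact: block_linked iP iB jBi.
have [i0 [_ [[i0B _ _] _ [w0 _ _]]]] := block_ends iP.
have [j0 [_ [[j0B _ _] _ [v0 _ _]]]] := block_ends jP.
have l0 : linked w i0 j0.
  have lt := @linked_equiv n w.
  have ltr a b c : linked w a b -> linked w b c -> linked w a c.
    by move=> ab bc; have [_ /(_ ab) ->] := lt a b c (in_setT _) (in_setT _) (in_setT _).
  exact: ltr (block_linked iP i0B iB) (ltr _ _ _ lij (block_linked jP jB j0B)).
have eq0 : i0 = j0.
  apply/val_inj/eqP; rewrite eqn_leq (linked_f_min w0 l0) /=.
  by apply: (linked_f_min v0); rewrite linked_sym.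
rewrite -eq0 in j0B; have -> // : pblock P i = pblock P j.
by rewrite -(def_pblock tiP jP j0B) -(def_pblock tiP iP i0B).
Qed.

End RiordanWord.

Lemma partition_word_inj n : {in riordan_set n &, injective (@partition_word n)}.
Proof.
have sub (P Q : {set {set 'I_n}}) : P \in riordan_set n -> Q \in riordan_set n ->
    partition_word P = partition_word Q -> P \subset Q.
  move=> rP rQ eqw; have [/and3P[_ tiP P0] _ _] := riordan_setP _ rP.
  have [/and3P[/eqP covQ _ _] _ _] := riordan_setP _ rQ.
  apply/subsetP => B BP; have /set0Pn[i iB] : B != set0 by apply: contraNneq P0 => <-.
  have -> : B = pblock Q i.
    rewrite -(def_pblock tiP BP iB); apply/setP => j.
    by rewrite !pblock_riordan // eqw.
  by apply: pblock_mem; rewrite covQ inE.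
by move=> P Q rP rQ eqw; apply/eqP; rewrite eqEsubset !sub.
Qed.

(** * Disjoint hulls on the circle and noncrossing partitions *)

Section Hulls.
Variables (R : realType) (n : nat).
Implicit Types (B C : {set 'I_n}) (p : R * R).

(** At the circle point of parameter t, a quadratic polynomial x + y t + z t^2
divided by 1 + t^2 is an affine function of the coordinates, namely this one; see
[conic_circle].  So separating lines are given by quadratic polynomials. *)
Definition conic (x y z : R) p : R :=
  (x * (1 + p.1) + y * p.2 + z * (1 - p.1)) / 2.

Lemma one_sqr_gt0 (t : R) : 0 < 1 + t ^+ 2.
Proof. by rewrite ltr_pwDl ?ltr01 ?sqr_ge0. Qed.

Lemma conic_circle x y z (i : 'I_n) :
  conic x y z (circle_point R i) =
  (x + y * i%:R + z * i%:R ^+ 2) / (1 + i%:R ^+ 2).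
Proof.
rewrite /conic /circle_point /=; field.
by rewrite gt_eqF ?one_sqr_gt0.
Qed.

Lemma conic_hull x y z B p (w : 'I_n -> R) :
  \sum_(i in B) w i = 1 ->
  p.1 = \sum_(i in B) w i * (circle_point R i).1 ->
  p.2 = \sum_(i in B) w i * (circle_point R i).2 ->
  conic x y z p = \sum_(i in B) w i * conic x y z (circle_point R i).
Proof.
move=> w1 p1 p2; pose pt := circle_point R (n := n).
rewrite (eq_bigr (fun i => (x * (w i + w i * (pt i).1) + y * (w i * (pt i).2)
  + z * (w i - w i * (pt i).1)) / 2)); last first.
  by move=> i _; rewrite /conic /pt; ring.
by rewrite -mulr_suml !big_split /= -!mulr_sumr big_split sumrB /= w1 -p1 -p2.
Qed.

(** The affine function given by the polynomial is nonnegative on the hull of B and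
negative on that of C. *)
Lemma hull_separation x y z B C p :
  (forall i, i \in B -> 0 <= x + y * i%:R + z * i%:R ^+ 2 :> R) ->
  (forall i, i \in C -> x + y * i%:R + z * i%:R ^+ 2 < 0 :> R) ->
  ~ (in_hull B p /\ in_hull C p).
Proof.
move=> qB qC [[u [u0 u1 up1 up2]] [v [v0 v1 vp1 vp2]]].
have ge0 : 0 <= conic x y z p.
  rewrite (conic_hull x y z u1 up1 up2); apply: sumr_ge0 => i iB.
  by rewrite mulr_ge0 ?u0 // conic_circle divr_ge0 ?qB // ltW ?one_sqr_gt0.
have le0 i : i \in C -> 0 <= - (v i * conic x y z (circle_point R i)).
  move=> iC; rewrite -mulrN mulr_ge0 ?v0 // conic_circle -mulNr divr_ge0 //.
    by rewrite oppr_ge0 ltW ?qC.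
  by rewrite ltW ?one_sqr_gt0.
have : \sum_(i in C) - (v i * conic x y z (circle_point R i)) == 0.
  rewrite eq_le sumr_ge0 // andbT sumrN oppr_le0.
  by rewrite -(conic_hull x y z v1 vp1 vp2).
rewrite psumr_eq0 // => /allP all0; move: (oner_neq0 R); rewrite -v1 big1 ?eqxx // => i iC.
have /implyP/(_ iC) := all0 i (mem_index_enum i).
rewrite oppr_eq0 mulf_eq0 conic_circle => /orP[/eqP //|].
by rewrite mulf_eq0 invr_eq0 lt_eqF ?qC //= gt_eqF ?one_sqr_gt0.
Qed.

Lemma chord_in_hull B (a c : 'I_n) (u v Z : R) :
  a \in B -> c \in B -> a != c -> 0 <= u -> 0 <= v -> 0 < Z ->
  Z = u * (1 + a%:R ^+ 2) + v * (1 + c%:R ^+ 2) ->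
  in_hull B ((u * (1 - a%:R ^+ 2) + v * (1 - c%:R ^+ 2)) / Z,
             (u * (2 * a%:R) + v * (2 * c%:R)) / Z).
Proof.
move=> aB cB ac u0 v0 Z0 ZE.
pose w i : R := if i == a then u * (1 + a%:R ^+ 2) / Z
                else if i == c then v * (1 + c%:R ^+ 2) / Z else 0.
have sumw (F : 'I_n -> R) : \sum_(i in B) w i * F i =
    u * (1 + a%:R ^+ 2) / Z * F a + v * (1 + c%:R ^+ 2) / Z * F c.
  have ca : c != a by rewrite eq_sym.
  rewrite (bigD1 a) //= (bigD1 c) /= ?cB // big1 ?addr0 => [|i].
    by rewrite /w !eqxx (negbTE ca).
  by case/andP=> /andP[_ /negbTE ia] /negbTE ic; rewrite /w ia ic mul0r.
have a0 := one_sqr_gt0 a%:R; have c0 := one_sqr_gt0 c%:R.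
exists w; split.
- move=> i _; rewrite /w; case: ifP => _.
    by apply: divr_ge0; [rewrite mulr_ge0 // ltW | rewrite ltW].
  by case: ifP => _ //; apply: divr_ge0; [rewrite mulr_ge0 // ltW | rewrite ltW].
- under eq_bigr do rewrite -[w _]mulr1.
  by rewrite sumw !mulr1 -mulrDl -ZE divff // gt_eqF.
- rewrite sumw /=; field.
  by rewrite !gt_eqF.
- rewrite sumw /=; field.
  by rewrite !gt_eqF.
Qed.

(** The third divided difference at a, b, c, d of a quadratic polynomial vanishes, and
its coefficients alternate in sign.  After clearing denominators, its positive and
negative parts give the common point of the chords ac and bd. *)
Lemma crossing_hulls B C (a b c d : 'I_n) :
  a \in B -> b \in C -> c \in B -> d \in C ->
  (a < b)%N -> (b < c)%N -> (c < d)%N ->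
  exists p, in_hull B p /\ in_hull C p.
Proof.
move=> aB bC cB dC; rewrite -!(ltr_nat R) => ab bc cd.
have ac := lt_trans ab bc; have bd := lt_trans bc cd; have ad := lt_trans ab bd.
have neq (i j : 'I_n) : (i%:R : R) < j%:R -> i != j.
  by apply: contraTneq => ->; rewrite ltxx.
pose A : R := a%:R; pose b' : R := b%:R; pose c' : R := c%:R; pose d' : R := d%:R.
pose Va := (c' - b') * (d' - b') * (d' - c'); pose Vc := (b' - A) * (d' - A) * (d' - b').
pose Vb := (c' - A) * (d' - A) * (d' - c'); pose Vd := (b' - A) * (c' - A) * (c' - b').
have Va0 : 0 < Va by rewrite !mulr_gt0 // subr_gt0.
have Vb0 : 0 < Vb by rewrite !mulr_gt0 // subr_gt0.
have Vc0 : 0 < Vc by rewrite !mulr_gt0 // subr_gt0.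
have Vd0 : 0 < Vd by rewrite !mulr_gt0 // subr_gt0.
pose Z := Va * (1 + A ^+ 2) + Vc * (1 + c' ^+ 2).
have Z0 : 0 < Z by rewrite addr_gt0 // mulr_gt0 // one_sqr_gt0.
exists ((Va * (1 - A ^+ 2) + Vc * (1 - c' ^+ 2)) / Z, (Va * (2 * A) + Vc * (2 * c')) / Z).
split; first by apply: chord_in_hull; rewrite ?neq // ltW.
have -> : Va * (1 - A ^+ 2) + Vc * (1 - c' ^+ 2) = Vb * (1 - b' ^+ 2) + Vd * (1 - d' ^+ 2).
  by rewrite /Va /Vb /Vc /Vd; ring.
have -> : Va * (2 * A) + Vc * (2 * c') = Vb * (2 * b') + Vd * (2 * d').
  by rewrite /Va /Vb /Vc /Vd; ring.
apply: chord_in_hull; rewrite ?neq // ?ltW //.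
by rewrite /Z /Va /Vb /Vc /Vd -/b' -/d'; ring.
Qed.

(** C lies between two elements l < r of B such that no element of B lies strictly
between them, or after all of B; the polynomial (t - l) (t - r) separates them.  In the
second case r = n, which is greater than all labels, serves as well. *)
Lemma noncrossing_hulls B C p : [disjoint B & C] ->
  (forall (a b c d : 'I_n), a \in B -> b \in C -> c \in B -> d \in C ->
     (a < b)%N -> (b < c)%N -> (c < d)%N -> False) ->
  (exists2 i : 'I_n, i \in B & forall j, j \in C -> (i < j)%N) ->
  ~ (in_hull B p /\ in_hull C p).
Proof.
move=> dBC nc [i iB i_lt].
case: (set_0Vmem C) => [C0|[c cC]].
  by case=> _ [w []]; rewrite C0 big_set0 => _ /esym/eqP; rewrite oner_eq0.
have [c0 c0C min_c0] := arg_minnP (fun i : 'I_n => val i) cC.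
have {}c0C : c0 \in C by [].
have {}min_c0 j : j \in C -> (c0 <= j)%N by apply: min_c0.
pose below (j : 'I_n) := (j \in B) && (j < c0)%N.
have below_i : below i by rewrite /below iB i_lt.
have [l /andP[lB l_lt] max_l] := arg_maxnP (fun i : 'I_n => val i) below_i.
have {}max_l (j : 'I_n) : j \in B -> (j < c0)%N -> (j <= l)%N.
  by move=> jB lt; apply: max_l; rewrite /below jB.
have gt_c0 (j : 'I_n) : j \in B -> (c0 <= j)%N -> (c0 < j)%N.
  move=> jB le; rewrite ltn_neqAle le andbT; apply/negP => /eqP/val_inj ej.
  by rewrite -ej in jB; have /disjoint_setI0/setP/(_ c0) := dBC; rewrite !inE jB c0C.
have [r [r_gt rB rC]] : exists r : nat, [/\ (l < r)%N,
    forall j : 'I_n, j \in B -> (j <= l)%N || (r <= j)%N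
    & forall j : 'I_n, j \in C -> (j < r)%N].
  pose above (j : 'I_n) := (j \in B) && (c0 < j)%N.
  case: (pickP above) => [j0 j0P|none].
    have [r /andP[rB r_gt] min_r] := arg_minnP (fun i : 'I_n => val i) j0P.
    exists r; split=> [|j jB|j jC]; first exact: ltn_trans r_gt.
      case: (ltnP j c0) => [/max_l-> //|/(gt_c0 _ jB) lt].
      by apply/orP; right; apply: min_r; rewrite /above jB.
    rewrite ltnNge; apply/negP; rewrite leq_eqVlt => /orP[/eqP/val_inj ej|lt].
      by rewrite ej in rB; have /disjoint_setI0/setP/(_ j) := dBC; rewrite !inE rB jC.
    exact: (nc l c0 r j).
  exists n; split=> // j jB; apply/orP; left; apply: max_l => //.
  by rewrite ltnNge; apply/negP => /(gt_c0 _ jB) lt; have := none j; rewrite /above jB lt.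
have lC j : j \in C -> (l < j)%N by move=> /min_c0; exact: leq_trans.
have qE (j : 'I_n) : l%:R * r%:R + - (l%:R + r%:R) * j%:R + 1 * j%:R ^+ 2 =
    (j%:R - l%:R) * (j%:R - r%:R) :> R by ring.
apply: (@hull_separation (l%:R * r%:R) (- (l%:R + r%:R)) 1) => j; rewrite qE.
  case/rB/orP=> [le|ge].
    by rewrite mulr_le0 ?subr_le0 ?ler_nat // ltnW // (leq_ltn_trans le).
  by rewrite mulr_ge0 ?subr_ge0 ?ler_nat // ltnW // (leq_trans r_gt).
by move=> jC; rewrite pmulr_rlt0 ?subr_gt0 ?subr_lt0 ltr_nat ?rC ?lC.
Qed.

Lemma riordan_partitionE (P : {set {set 'I_n}}) :
  riordan_partition R P <-> P \in riordan_set n.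
Proof.
split=> [[partP P2 hulls]|/riordan_setP[partP P2 nc]].
  apply/riordan_setP; split=> // B C a b c d BP CP BC aB bC cB dC ab bc cd.
  have [p hp] := crossing_hulls aB bC cB dC ab bc cd.
  exact: hulls BP CP BC p hp.
split=> // B C BP CP BC p; have /and3P[_ tiP P0] := partP.
have dBC : [disjoint B & C] by move/trivIsetP: tiP; exact.
have mem_min D : D \in P -> exists2 i : 'I_n, i \in D & forall j, j \in D -> (i <= j)%N.
  move=> DP; have /set0Pn[i iD] : D != set0 by apply: contraNneq P0 => <-.
  by have [j jD min_j] := arg_minnP (fun i : 'I_n => val i) iD; exists j.
have [[i iB min_i] [j jC min_j]] := (mem_min B BP, mem_min C CP).
case: (ltngtP i j) => [ij|ji|/val_inj ij].
- apply: noncrossing_hulls => //.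
    by move=> a b c d; apply: nc.
  by exists i => // k /min_j; exact: leq_trans.
- case=> hB hC; suff: ~ (in_hull C p /\ in_hull B p) by apply.
  apply: noncrossing_hulls; first by rewrite disjoint_sym.
    by move=> a b c d; apply: nc; rewrite // eq_sym.
  by exists j => // k /min_i; exact: leq_trans.
- by rewrite ij in iB; have /disjoint_setI0/setP/(_ j) := dBC; rewrite !inE iB jC.
Qed.

End Hulls.

(** * The state sum of a union of linear trees *)

Section ColorSum.
Variable (H : finType).
Notation coloring := {ffun H -> 'I_3}.

Definition recolor (x : coloring) h c : coloring :=
  [ffun h' => if h' == h then c else x h'].

(** An iterated sum over the colors of the half-edges in a list.  It allows to carry
out the state sum in the order in which a path runs through the half-edges, whatever
the order of the finite type of half-edges. *)
Fixpoint color_sum (l : seq H) (G : coloring -> rat) (x : coloring) : rat :=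
  if l is h :: l' then \sum_c color_sum l' G (recolor x h c) else G x.

Lemma eq_color_sum l G G' x : G =1 G' -> color_sum l G x = color_sum l G' x.
Proof.
move=> eqG; elim: l x => [|h l IHl] x /=; first exact: eqG.
by apply: eq_bigr => c _.
Qed.

Lemma color_sum_cat l1 l2 G x :
  color_sum (l1 ++ l2) G x = color_sum l1 (color_sum l2 G) x.
Proof. by elim: l1 x => //= h l IHl x; apply: eq_bigr => c _. Qed.

Lemma color_sumMl l a G x :
  (forall h c y, h \in l -> a (recolor y h c) = a y) ->
  color_sum l (fun y => a y * G y) x = a x * color_sum l G x.
Proof.
elim: l x => [|h l IHl] x //= a_inv.
rewrite mulr_sumr; apply: eq_bigr => c _.
rewrite IHl => [|h' c' y h'l]; first by rewrite a_inv ?mem_head.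
by rewrite a_inv // inE h'l orbT.
Qed.

Lemma color_sumE l G x0 : uniq l ->
  color_sum l G x0 =
  \sum_(x : coloring | [forall h, (h \notin l) ==> (x h == x0 h)]) G x.
Proof.
elim: l x0 => [|h l IHl] x0 /=.
  move=> _; rewrite (big_pred1 x0) // => x; apply/forallP/eqP => [eqx|-> h //].
  by apply/ffunP => h; apply/eqP/eqx.
case/andP=> hl ul; rewrite (partition_big (fun x : coloring => x h) predT) //=.
apply: eq_bigr => c _; rewrite IHl //; apply: eq_bigl => x.
apply/forallP/andP => [eqx|[/forallP eqx /eqP xh] h'].
  split; last by have /implyP/(_ hl) := eqx h; rewrite ffunE eqxx.
  apply/forallP => h'; rewrite inE negb_or; apply/implyP => /andP[h'h h'l].
  by have /implyP/(_ h'l) := eqx h'; rewrite ffunE (negbTE h'h).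
apply/implyP => h'l; rewrite ffunE; case: (eqVneq h' h) => [->|h'h]; first exact/eqP.
by apply: (implyP (eqx h')); rewrite inE negb_or h'h.
Qed.

Lemma color_sum_all l G x0 : uniq l -> (forall h, h \in l) ->
  color_sum l G x0 = \sum_x G x.
Proof.
move=> ul all_l; rewrite color_sumE //; apply: eq_bigl => x.
by apply/forallP => h; rewrite all_l.
Qed.

End ColorSum.

Lemma kappa_c x z : \sum_v kappa x v * c_coef v z = (x == z)%:R.
Proof. by rewrite sum_sl2; move: x z; do 2!elim/sl2_ind; apply/eqP; vm_compute. Qed.

Lemma b_coef_cyc x y z : b_coef x y z = b_coef y z x.
Proof. by move: x y z; do 3!elim/sl2_ind; apply/eqP; vm_compute. Qed.

Lemma kappaC x y : kappa x y = kappa y x.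
Proof. by move: x y; do 2!elim/sl2_ind; apply/eqP; vm_compute. Qed.

Lemma c_coefC x y : c_coef x y = c_coef y x.
Proof. by move: x y; do 2!elim/sl2_ind; apply/eqP; vm_compute. Qed.

(** A product of an invariant weight over orbit representatives can be computed from
any list containing one element of each orbit. *)
Lemma prod_transversal (H : finType) (orb : H -> seq H) (l : seq H)
    (D rep : pred H) (w : H -> rat) :
  perm_eq (flatten [seq orb h | h <- l]) (enum D) -> subpred rep D ->
  (forall h, h \in l -> \prod_(x <- orb h | rep x) w x = w h) ->
  \prod_(h | rep h) w h = \prod_(h <- l) w h.
Proof.
move=> perm_l rep_D w_orb.
transitivity (\prod_(h <- enum D | rep h) w h).
  rewrite big_enum_cond /=; apply: eq_bigl => h.
  by case: (boolP (rep h)) => [/rep_D Dh|_]; rewrite ?andbF // andbT; exact: esym Dh.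
rewrite -(perm_big _ perm_l) big_flatten big_map /=.
by apply: eq_big_seq.
Qed.

Lemma uniq_flatten_block (I : eqType) (ss : seq (seq I)) (k : I) l l' :
  uniq (flatten ss) -> l \in ss -> k \in l -> l' \in ss -> k \in l' -> l' = l.
Proof.
elim: ss => [|l0 ss IHss] //=; rewrite cat_uniq => /and3P[_ /hasPn nl0 uss].
have out l1 : l1 \in ss -> k \in l1 -> k \notin l0.
  by move=> l1s kl1; apply: nl0; apply/flattenP; exists l1.
rewrite !inE => /predU1P[->|ls] kl /predU1P[->|l's] kl' //.
- by have := out _ l's kl'; rewrite kl.
- by have := out _ ls kl; rewrite kl'.
- exact: IHss.
Qed.

Section Diagram.
Variables (n : nat) (T : jacobi_diagram n).
Notation opp := (Defs.opp T).
Notation nxt := (nxt T).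
Notation leg := (leg T).
Implicit Types (h : half_edge T) (l : seq 'I_n) (s : mindex n).
Implicit Types x y : {ffun half_edge T -> 'I_3}.

Lemma opp_inj : injective opp. Proof. exact: inv_inj (@oppK n T). Qed.

Lemma nxt_inj : injective nxt.
Proof. by apply: (can_inj (g := nxt \o nxt)) => h; apply: nxt3. Qed.

Lemma trivalent_leg i : trivalent (leg i) = false.
Proof. by rewrite /trivalent legP codom_f. Qed.

Lemma trivalent_nxt h : trivalent (nxt h) = trivalent h.
Proof. by rewrite /trivalent (inj_eq nxt_inj). Qed.

Lemma prod_edge_orbit (w : half_edge T -> rat) h :
  (forall h, w (opp h) = w h) ->
  \prod_(x <- [:: h; opp h] | edge_rep x) w x = w h.
Proof.
move=> w_opp; rewrite !big_cons big_nil /edge_rep oppK w_opp.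
have: enum_rank h != enum_rank (opp h).
  by rewrite (inj_eq enum_rank_inj) eq_sym opp_neq.
by rewrite -(inj_eq val_inj) /= neq_ltn; case: ltngtP => // _ _; rewrite mulr1.
Qed.

Lemma prod_vertex_orbit (w : half_edge T -> rat) h : trivalent h ->
  (forall h, w (nxt h) = w h) ->
  \prod_(x <- [:: h; nxt h; nxt (nxt h)] | vertex_rep x) w x = w h.
Proof.
move=> h3 w_nxt; rewrite !big_cons big_nil /vertex_rep !trivalent_nxt h3 !nxt3 !w_nxt /=.
have rank_neq h1 h2 : h1 != h2 -> (enum_rank h1 : nat) != enum_rank h2.
  by move=> neq; rewrite (inj_eq val_inj) (inj_eq enum_rank_inj).
have := rank_neq _ _ h3.
have : enum_rank (nxt (nxt h)) != enum_rank (nxt h) :> nat.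
  by apply: rank_neq; rewrite (inj_eq nxt_inj).
have : enum_rank (nxt (nxt h)) != enum_rank h :> nat.
  by apply: rank_neq; rewrite -(inj_eq nxt_inj) nxt3 eq_sym.
move: (nat_of_ord _) (nat_of_ord _) (nat_of_ord _) => a b c.
case: (ltngtP a b) => //; case: (ltngtP a c) => //; case: (ltngtP b c) => //=;
  rewrite ?mulr1 //; lia.
Qed.

Definition foot i := opp (leg i).

Lemma opp_foot i : opp (foot i) = leg i. Proof. exact: oppK. Qed.

Lemma path_from_cons h i l : (0 < size l)%N ->
  path_from h (i :: l) = [&& trivalent (foot i), opp h == nxt (nxt (foot i))
    & path_from (nxt (foot i)) l].
Proof. by case: l. Qed.

Definition tripod i := [:: foot i; nxt (foot i); nxt (nxt (foot i))].

Lemma mem_tripod_nxt h i : (nxt h \in tripod i) = (h \in tripod i).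
Proof.
rewrite !inE -[X in nxt h == X](nxt3 (foot i)) !(inj_eq nxt_inj).
by rewrite orbC -orbA.
Qed.

(** For the labels l that follow a half-edge h in [path_from h l], the labels with a
trivalent vertex are all but the last one. *)
Definition middles l := if l is i :: l' then belast i l' else [::].

(** The half-edges met by [path_from h l] after h, in an order in which those of each
edge of [chain_edges h l] are consecutive. *)
Fixpoint chain_rest h l : seq (half_edge T) :=
  match l with
  | [::] => [::]
  | [:: i] => [:: leg i]
  | i :: l' => [:: opp h, foot i, leg i, nxt (foot i) & chain_rest (nxt (foot i)) l']
  end.

Fixpoint chain_edges h l : seq (half_edge T) :=
  match l with
  | [::] => [::]
  | [:: i] => [:: h]
  | i :: l' => [:: h, foot i & chain_edges (nxt (foot i)) l']
  end.

Lemma chain_restE h l : path_from h l ->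
  h :: chain_rest h l = flatten [seq [:: h; opp h] | h <- chain_edges h l].
Proof.
elim: l h => [|i [|j l] IHl] h //; first by move/eqP=> /= ->.
case/and3P=> _ _ pl.
rewrite -[LHS]/([:: h, opp h, foot i, leg i
  & nxt (foot i) :: chain_rest (nxt (foot i)) (j :: l)]).
by rewrite IHl //= /foot oppK.
Qed.

Lemma chain_rest_perm h l : path_from h l ->
  perm_eq (chain_rest h l)
    ([seq leg i | i <- l] ++ flatten [seq tripod i | i <- middles l]).
Proof.
elim: l h => [|i [|j l] IHl] h //; case/and3P=> _ /eqP; rewrite -/(foot i) => oph pl.
have {IHl} := IHl _ pl; rewrite -[chain_rest h _]/([:: opp h, foot i, leg i, nxt (foot i)
  & chain_rest (nxt (foot i)) (j :: l)]).
rewrite -[[seq leg k | k <- i :: _]]/(leg i :: [seq leg k | k <- j :: l]).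
rewrite -[flatten [seq tripod k | k <- middles [:: i, j & l]]]/(
  tripod i ++ flatten [seq tripod k | k <- middles (j :: l)]) oph.
move: (chain_rest _ _) (map _ _) (flatten _) => r m f /permP rE; apply/permP => a.
by have /= := rE a; rewrite /= !count_cat /= ?count_cat /=; lia.
Qed.

Lemma eq_foot h i : (h == foot i) = (opp h == leg i).
Proof. by rewrite -(inj_eq opp_inj) /foot oppK. Qed.

Lemma path_from_neq_foot (M : pred 'I_n) h l : path_from h l ->
  (forall i, i \in l -> i \notin middles l -> ~~ M i) ->
  forall j, M j -> h != foot j.
Proof.
move=> pl lastM j Mj; rewrite eq_foot; case: l => [|i [|k l]] // in pl lastM *.
  rewrite (eqP pl) (inj_eq (@leg_inj _ T)); apply: contraTneq Mj => <-.
  by apply: lastM; rewrite ?mem_head.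
case/and3P: pl => tri /eqP -> _; apply: contraTneq tri => e.
by rewrite -trivalent_nxt -trivalent_nxt e trivalent_leg.
Qed.

(** The three half-edges at the vertex of a middle label are told from the feet of the
other labels of M by their opposites, which are legs only for a foot or at the ends of
a path.  This is what makes all listed half-edges distinct. *)
Lemma path_from_middles (M : pred 'I_n) h l : uniq l -> path_from h l ->
  (forall j, M j -> h != leg j) -> (forall i, i \in l -> i \notin middles l -> ~~ M i) ->
  forall i, i \in middles l -> trivalent (foot i) /\
    forall j, M j -> nxt (foot i) != foot j /\ nxt (nxt (foot i)) != foot j.
Proof.
elim: l h => [|i [|j l] IHl] h //; case/andP=> il ul.
case/and3P=> tri /eqP oph pl hM lastM k.
have lastM' a : a \in j :: l -> a \notin middles (j :: l) -> ~~ M a.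
  move=> ajl amid; apply: lastM; first by rewrite inE ajl orbT.
  rewrite -[middles _]/(i :: middles (j :: l)) inE negb_or amid andbT.
  by apply: contraNneq il => <-.
rewrite -[middles _]/(i :: middles (j :: l)) inE => /predU1P[->|]; last first.
  apply: IHl pl _ lastM' k => // a _; apply: contraTneq tri => e.
  by rewrite -trivalent_nxt e trivalent_leg.
split=> // a Ma; split; first exact: (@path_from_neq_foot M _ (j :: l) pl lastM').
by rewrite -oph (inj_eq opp_inj) hM.
Qed.

Definition component (l : seq 'I_n) : seq (half_edge T) :=
  if l is i :: l' then leg i :: chain_rest (leg i) l' else [::].

Definition component_edges (l : seq 'I_n) : seq (half_edge T) :=
  if l is i :: l' then chain_edges (leg i) l' else [::].

Definition vertex_weight (x : {ffun half_edge T -> 'I_3}) h : rat :=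
  b_coef (x h) (x (nxt h)) (x (nxt (nxt h))).

Fixpoint chain_weight (s : mindex n) h l (x : {ffun half_edge T -> 'I_3}) : rat :=
  match l with
  | [::] => 1
  | [:: i] => edge_weight x h * (x (leg i) == s i)%:R
  | i :: l' => edge_weight x h * edge_weight x (foot i) * (x (leg i) == s i)%:R
      * vertex_weight x (foot i) * chain_weight s (nxt (foot i)) l' x
  end.

Definition component_weight (s : mindex n) l (x : {ffun half_edge T -> 'I_3}) : rat :=
  if l is i :: l' then (x (leg i) == s i)%:R * chain_weight s (leg i) l' x else 1.

Lemma chain_weightE s x h l : path_from h l -> chain_weight s h l x =
  \prod_(h <- chain_edges h l) edge_weight x h
  * \prod_(i <- l) (x (leg i) == s i)%:R
  * \prod_(i <- middles l) vertex_weight x (foot i).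
Proof.
elim: l h => [|i [|j l] IHl] h //; first by rewrite /= !big_seq1 big_nil mulr1.
case/and3P=> _ _ pl.
rewrite -[chain_weight _ _ _ _]/(edge_weight x h * edge_weight x (foot i)
  * (x (leg i) == s i)%:R * vertex_weight x (foot i)
  * chain_weight s (nxt (foot i)) (j :: l) x).
rewrite -[middles _]/(i :: middles (j :: l)).
rewrite -[chain_edges _ _]/[:: h, foot i & chain_edges (nxt (foot i)) (j :: l)].
rewrite (IHl _ pl) !(big_cons _ _ h) !(big_cons _ _ (foot i)) !(big_cons _ _ i) /=.
by ring.
Qed.

Lemma chain_weight_local s h l x y : path_from h l ->
  (forall k, k \in h :: chain_rest h l -> x k = y k) ->
  chain_weight s h l x = chain_weight s h l y.
Proof.
elim: l h => [|i [|j l] IHl] h //.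
  move=> /= /eqP oph xy; rewrite /edge_weight oph.
  by rewrite !xy ?inE ?eqxx ?orbT.
case/and3P=> _ /eqP oph pl xy.
rewrite -![chain_weight _ h _ _]/(edge_weight _ h * edge_weight _ (foot i)
  * (_ (leg i) == s i)%:R * vertex_weight _ (foot i)
  * chain_weight s (nxt (foot i)) (j :: l) _).
have rest k : k \in [:: h, opp h, foot i, leg i, nxt (foot i)
    & chain_rest (nxt (foot i)) (j :: l)] -> x k = y k by exact: xy.
rewrite (IHl _ pl) => [|k k_rest]; last by apply: rest; rewrite 4!inE k_rest !orbT.
rewrite /edge_weight /vertex_weight -oph opp_foot.
by rewrite !rest // !inE eqxx ?orbT.
Qed.

Lemma component_weight_local s l x y : linear_component T l ->
  (forall k, k \in component l -> x k = y k) ->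
  component_weight s l x = component_weight s l y.
Proof.
case: l => [|i l] //= /andP[_ pl] xy.
by rewrite (chain_weight_local s pl xy) xy ?mem_head.
Qed.

Lemma sum_delta (c : 'I_3) (F : 'I_3 -> rat) : \sum_d (d == c)%:R * F d = F c.
Proof.
rewrite (bigD1 c) //= eqxx mul1r big1 ?addr0 // => d /negbTE->.
by rewrite mul0r.
Qed.

(** Summing over the half-edges after h leaves a function of the color of h.  If h
belongs to a trivalent vertex, its edge still has to be contracted by kappa; at an
edge to a univalent vertex the contraction of c by kappa gives the identity. *)
Lemma chain_sum s h l x : path_from h l -> uniq (h :: chain_rest h l) ->
  color_sum (chain_rest h l) (chain_weight s h l) x =
  if trivalent h then \sum_v kappa (x h) v * chain_coef v [seq s i | i <- l]
  else chain_coef (x h) [seq s i | i <- l].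
Proof.
elim: l h x => [|i [|j l] IHl] h x //.
  move=> /= /eqP oph; rewrite andbT inE => h_leg.
  under eq_bigr => c _ do
    rewrite /edge_weight oph trivalent_leg !ffunE eqxx (negbTE h_leg) mulrC.
  case: (trivalent h); last by rewrite sum_delta.
  by rewrite (sum_delta _ (fun c => (x h == c)%:R)) kappa_c.
case/and3P=> tri /eqP oph pl.
pose q := nxt (foot i); pose r := chain_rest q (j :: l).
rewrite -[chain_rest _ _]/[:: opp h, foot i, leg i, q & r] => u.
pose e (a : 'I_3) : rat := if trivalent h then kappa (x h) a else (x h == a)%:R.
pose K u := \sum_v kappa u v * chain_coef v [seq s k | k <- j :: l].
have u_r : uniq (q :: r) by move: u => /= /and5P[].
transitivity (\sum_a \sum_b \sum_d \sum_v
    e a * ((b == d)%:R * ((d == s i)%:R * (b_coef b v a * K v)))).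
  apply: eq_bigr => a _; apply: eq_bigr => b _; apply: eq_bigr => d _.
  apply: eq_bigr => v _; set z := recolor _ q v.
  have /and3P[_ /hasPn out_r _] : [&& uniq [:: h; opp h; foot i; leg i; q],
      ~~ has (mem [:: h; opp h; foot i; leg i; q]) r & uniq r] by rewrite -cat_uniq.
  have out k k' : k \in [:: h; opp h; foot i; leg i; q] -> k' \in r -> (k == k') = false.
    by move=> k_in; apply: contraTF => /eqP <-; apply: contraL k_in; exact: out_r.
  pose A y := edge_weight y h * edge_weight y (foot i) * (y (leg i) == s i)%:R
    * vertex_weight y (foot i).
  transitivity (A z * color_sum r (chain_weight s q (j :: l)) z).
    rewrite -color_sumMl // => k c y kr.
    rewrite /A /edge_weight /vertex_weight -oph opp_foot !ffunE.
    by rewrite !(out _ k) ?inE ?eqxx ?orbT.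
  rewrite IHl // trivalent_nxt tri -/(K _) /A /edge_weight /vertex_weight -oph opp_foot.
  rewrite tri trivalent_leg oph !trivalent_nxt tri -oph -/q.
  move: u; rewrite /= !inE !negb_or => /andP[/and5P[h1 h2 h3 h4 _]].
  move=> /andP[/and4P[p1 p2 p3 _] /andP[/and3P[g1 g2 _] /andP[/andP[l1 _] _]]].
  have -> : z h = x h by rewrite !ffunE !ifN.
  have -> : z (opp h) = a by rewrite !ffunE eqxx !ifN.
  have -> : z (foot i) = b by rewrite !ffunE eqxx !ifN.
  have -> : z (leg i) = d by rewrite !ffunE eqxx !ifN.
  have -> : z q = v by rewrite !ffunE eqxx.
  by rewrite -!mulrA /e; case: (trivalent h).
transitivity (\sum_a e a * chain_coef a [seq s k | k <- [:: i, j & l]]).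
  apply: eq_bigr => a _; rewrite exchange_big.
  under eq_bigr => d _ do under eq_bigr => b _ do rewrite -!mulr_sumr mulrCA.
  under eq_bigr => d _ do rewrite sum_delta mulrCA.
  rewrite sum_delta.
  rewrite -[chain_coef a _]/(\sum_v bmat a (s i) v
    * chain_coef v [seq s k | k <- j :: l]).
  congr (_ * _); under eq_bigr do rewrite mulr_sumr.
  rewrite exchange_big; apply: eq_bigr => v _; rewrite mulr_suml.
  by apply: eq_bigr => w _; rewrite mulrA -b_coef_cyc.
rewrite /e; case: (trivalent h) => //.
under eq_bigr do rewrite eq_sym.
exact: sum_delta.
Qed.

Lemma component_sum s l x : uniq (component l) -> linear_component T l ->
  color_sum (component l) (component_weight s l) x = linear_coef [seq s i | i <- l].
Proof.
case: l => [|i l] //= /andP[il ul] /andP[_ pl].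
transitivity (\sum_c (c == s i)%:R * chain_coef c [seq s k | k <- l]).
  apply: eq_bigr => c _; rewrite color_sumMl ?ffunE ?eqxx => [|h c' y hl].
    by rewrite chain_sum /= ?il // trivalent_leg ffunE eqxx.
  by rewrite ffunE ifN //; apply: contraNneq il => {1}->.
by rewrite sum_delta.
Qed.

Section Components.
Variable ss : seq (seq 'I_n).
Hypothesis ss_uniq : uniq (flatten ss).
Hypothesis ss_all : forall i, i \in flatten ss.
Hypothesis ss_comp : forall l, l \in ss -> linear_component T l.

Let inner := flatten [seq middles (behead l) | l <- ss].
Let halves := flatten [seq component l | l <- ss].

Lemma component_perm : perm_eq halves
  ([seq leg i | i <- flatten ss] ++ flatten [seq tripod i | i <- inner]).
Proof.
rewrite /halves /inner; elim: ss ss_comp => [|l ss' IHss] comp //=.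
have {IHss} := IHss (fun l' l's => comp l' (@mem_behead _ (l :: ss') l' l's)).
have := comp l (mem_head _ _); case: l {comp} => [|i l] //= /andP[_ pl].
have := chain_rest_perm pl; rewrite !map_cat !flatten_cat.
move: (chain_rest _ _) (map _ l) (map _ (middles l)) (map _ (flatten ss')) => r a b c.
move: (flatten b) (flatten _) (flatten _) => {}b d e.
move=> /permP rE /permP eE; apply/permP => p; have /= := rE p; have /= := eE p.
by rewrite /= !count_cat /= ?count_cat; lia.
Qed.

Lemma sub_middles l i : i \in middles l -> i \in l.
Proof. by case: l => [|j l] //=; exact: mem_belast. Qed.

Lemma inner_facts i : i \in inner -> trivalent (foot i) /\
  forall j, j \in inner -> nxt (foot i) != foot j /\ nxt (nxt (foot i)) != foot j.
Proof.
case/flatten_mapP=> l lss il.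
have := ss_comp lss; case: l lss il => [|i0 l] //= lss il /andP[/andP[i0l ul] pl].
have only k l' : l' \in ss -> k \in l' -> k \in i0 :: l -> l' = i0 :: l.
  by move=> l'ss kl' kl; apply: (uniq_flatten_block ss_uniq lss kl l'ss kl').
have last_out k : k \in i0 :: l -> k \notin middles l -> ~~ (k \in inner).
  move=> kl kmid; apply/flatten_mapP => -[l' l'ss kl'].
  have el' := only k l' l'ss (mem_behead (sub_middles kl')) kl.
  by rewrite el' /= (negbTE kmid) in kl'.
apply: (path_from_middles (M := mem inner) ul pl) => //.
  move=> j jM; rewrite (inj_eq (@leg_inj _ T)); apply: contraTneq jM => <-.
  by apply: last_out; rewrite ?mem_head //; apply: contraNN i0l; exact: sub_middles.
by move=> k kl; apply: last_out; rewrite inE kl orbT.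
Qed.

Lemma halves_uniq : uniq halves.
Proof.
rewrite (perm_uniq component_perm) cat_uniq map_inj_uniq; last exact: leg_inj.
rewrite ss_uniq /=.
have tri h i : i \in inner -> h \in tripod i -> trivalent h.
  move=> iM; have [tri _] := inner_facts iM.
  by rewrite !inE => /or3P[] /eqP->; rewrite ?trivalent_nxt.
apply/andP; split.
  apply/hasPn => h /flatten_mapP[i iM hi]; apply/mapP => -[j _ hj].
  by have := tri h i iM hi; rewrite hj trivalent_leg.
have inner_uniq : uniq inner.
  rewrite /inner; move: ss_uniq; apply: subseq_uniq.
  elim: (ss) => //= l ss' IHss; apply: cat_subseq => //.
  case: l => [|i [|j l]] //; apply: (subseq_trans _ (subseq_cons (j :: l) i)).
  by rewrite [X in subseq _ X]lastI subseq_rcons.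
suff gen M : uniq M -> {subset M <= inner} -> uniq (flatten [seq tripod i | i <- M]).
  exact: gen.
elim: M => [|i M IHM] // /andP[iM uM] sub.
rewrite -[flatten _]/(tripod i ++ flatten [seq tripod j | j <- M]) cat_uniq.
rewrite IHM // ?andbT; last by move=> j jM; apply: sub; rewrite inE jM orbT.
have iI : i \in inner by apply: sub; rewrite mem_head.
have [tri_i nfi] := inner_facts iI.
apply/andP; split.
  rewrite /= !inE !negb_or andbT -andbA.
  have nf : nxt (foot i) != foot i by [].
  rewrite [foot i == _]eq_sym nf [nxt (foot i) == _]eq_sym (inj_eq nxt_inj) nf.
  by rewrite -(inj_eq nxt_inj) nxt3 nf.
apply/hasPn => h /flatten_mapP[j jM hj]; apply/negP => hi.
have : foot j \in tripod i.
  have /or3P : [|| h == foot j, h == nxt (foot j) | h == nxt (nxt (foot j))].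
    by move: hj; rewrite !inE.
  by case=> /eqP hE; move: hi; rewrite hE ?mem_tripod_nxt.
have [j1 j2] := nfi j (sub j (mem_behead (s := i :: M) jM)).
rewrite !inE (inj_eq opp_inj) (inj_eq (@leg_inj _ T)) eq_sym.
rewrite [foot j == _]eq_sym (negbTE j1) [foot j == _]eq_sym (negbTE j2) !orbF => /eqP ij.
by rewrite ij jM in iM.
Qed.

(** The listed half-edges are closed under both [opp] and [nxt], contain all legs, and
every half-edge is connected to a leg. *)
Lemma halves_all h : h \in halves.
Proof.
pose e := fun a b => (b == opp a) || (b == nxt a).
have opp_halves a : a \in halves -> opp a \in halves.
  rewrite /halves => /flatten_mapP[l ls al]; apply/flatten_mapP; exists l => //.
  have := ss_comp ls; case: l al {ls} => [|i l] //= al /andP[_ /chain_restE E].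
  move: al; rewrite E => /flatten_mapP[b bE ab]; apply/flatten_mapP; exists b => //.
  by move: ab; rewrite !inE => /orP[] /eqP->; rewrite ?oppK eqxx ?orbT.
have nxt_halves a : a \in halves -> nxt a \in halves.
  rewrite !(perm_mem component_perm) !mem_cat => /orP[/mapP[i iss ->]|].
    have /eqP-> : nxt (leg i) == leg i by rewrite legP codom_f.
    by rewrite map_f.
  case/flatten_mapP=> i iM xi; apply/orP; right; apply/flatten_mapP; exists i => //.
  by rewrite mem_tripod_nxt.
have back a b : e a b -> b \in halves -> a \in halves.
  case/orP=> /eqP->; first by move/opp_halves; rewrite oppK.
  by move/nxt_halves/nxt_halves; rewrite nxt3.
have [i /connectP[p]] := component_has_leg h.
elim: p h => [|a p IHp] h /=.
  by move=> _ <-; rewrite (perm_mem component_perm) mem_cat map_f.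
by case/andP=> ha path_p last_p; apply: back ha (IHp _ path_p last_p).
Qed.

Lemma halvesE : halves =
  flatten [seq [:: h; opp h] | h <- flatten [seq component_edges l | l <- ss]].
Proof.
rewrite /halves; elim: ss ss_comp => [|l ss' IHss] comp //=.
rewrite map_cat flatten_cat -IHss => [|l' l's]; last by rewrite comp // inE l's orbT.
have := comp l (mem_head _ _); case: l {comp} => [|i l] //= /andP[_ pl].
by rewrite -chain_restE.
Qed.

Lemma weight_components (s : mindex n) : W T s =
  \sum_(x : {ffun half_edge T -> 'I_3}) \prod_(l <- ss) component_weight s l x.
Proof.
rewrite ffunE big_mkcond; apply: eq_bigr => x _.
have -> : \prod_(l <- ss) component_weight s l x =
    (\prod_(h <- flatten [seq component_edges l | l <- ss]) edge_weight x h) *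
    (\prod_(i <- flatten ss) (x (leg i) == s i)%:R) *
    (\prod_(i <- inner) vertex_weight x (foot i)).
  rewrite /inner !big_flatten !big_map -!big_split /=; apply: eq_big_seq => l lss.
  have := ss_comp lss; case: l {lss} => [|i l] //= /andP[_ pl].
  rewrite (chain_weightE _ _ pl) big_cons; ring.
rewrite [X in _ * X * _](_ : _ = [forall i, x (leg i) == s i]%:R); last first.
  case: (boolP [forall i, _]) => [/forallP xs|]; first by apply: big1 => i _; rewrite xs.
  rewrite negb_forall => /existsP[i xi]; apply/eqP; rewrite prodf_seq_eq0.
  by apply/hasP; exists i; rewrite // (negbTE xi).
case: ifP => _; last by rewrite mulr0 mul0r.
rewrite mulr1 mulrC; congr (_ * _).
  apply: (prod_transversal (orb := fun h => [:: h; opp h]) (D := predT)) => //.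
    rewrite -halvesE; apply: uniq_perm halves_uniq (enum_uniq _) _ => h.
    by rewrite halves_all mem_enum.
  move=> h _; apply: prod_edge_orbit => {}h.
  rewrite /edge_weight oppK; case: (trivalent h); case: (trivalent _) => //.
  - exact: kappaC.
  - by rewrite eq_sym.
  - by rewrite eq_sym.
  - exact: c_coefC.
rewrite -[RHS](big_map foot predT (vertex_weight x)).
apply: (prod_transversal (orb := fun h => [:: h; nxt h; nxt (nxt h)])
                         (D := @trivalent _ T)).
- rewrite -map_comp; apply: uniq_perm (enum_uniq _) _.
    by move: halves_uniq; rewrite (perm_uniq component_perm) cat_uniq => /and3P[].
  move=> h; rewrite mem_enum -[h \in @trivalent _ T]/(trivalent h).
  apply/idP/idP => [/flatten_mapP[i iM]|h3].
    have [tri _] := inner_facts iM.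
    by rewrite /= !inE => /or3P[] /eqP->; rewrite ?trivalent_nxt.
  have := halves_all h; rewrite (perm_mem component_perm) mem_cat.
  by case/orP=> // /mapP[i _ hi]; move: h3; rewrite hi trivalent_leg.
- by move=> h /and3P[].
- move=> h /mapP[i iM ->]; apply: prod_vertex_orbit; first by have [] := inner_facts iM.
  by move=> {}h; rewrite /vertex_weight nxt3 [RHS]b_coef_cyc.
Qed.

(** The weights of the components involve disjoint sets of half-edges, so the state
sum is the product of their sums. *)
Lemma weight_linear (s : mindex n) :
  W T s = \prod_(l <- ss) linear_coef [seq s i | i <- l].
Proof.
rewrite weight_components -(color_sum_all _ [ffun=> sl2_h] halves_uniq halves_all).
rewrite /halves; have := halves_uniq; rewrite /halves; move: [ffun=> _] ss_comp.
elim: (ss) => [|l ss' IHss] x0 comp /=; first by rewrite !big_nil.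
rewrite cat_uniq => /and3P[ul /hasPn out uss].
rewrite color_sum_cat big_cons.
pose K := \prod_(l <- ss') linear_coef [seq s i | i <- l].
rewrite -/K mulrC -(component_sum s x0 ul (comp _ (mem_head _ _))).
rewrite -(color_sumMl (a := fun=> K)) //.
apply: eq_color_sum => x; rewrite mulrC.
rewrite -[K](IHss x _ uss) => [|l' l's]; last by rewrite comp // inE l's orbT.
rewrite -(color_sumMl (a := component_weight s l)) => [|h c y h_ss]; last first.
  apply: (component_weight_local _ (comp _ (mem_head _ _))) => k kl.
  by rewrite ffunE; case: eqP kl (out _ h_ss) => // -> /= -> .
by apply: eq_color_sum => y; rewrite big_cons.
Qed.

End Components.
End Diagram.

(** * Riordan trees and their weights *)

Lemma riordan_tree_weight (R : realType) n (T : jacobi_diagram n) P :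
  riordan_partition R P ->
  (forall B, B \in P -> exists s : seq 'I_n,
     [/\ s =i B, ordered_labels s & linear_component T s]) ->
  W T = partition_tensor P.
Proof.
move=> [partP _ _] comps; have /and3P[/eqP covP tiP _] := partP.
have enum_comp B : B \in P -> linear_component T (enum B).
  move=> BP; have [s [sB s_ord s_comp]] := comps B BP.
  rewrite -(irr_sorted_eq (@ltn_ord_trans n) _ s_ord (sorted_enum_ord B)) //.
    by move=> i; rewrite ltnn.
  by move=> i; rewrite sB mem_enum.
pose ss := [seq enum B | B : {set 'I_n} <- enum P].
have ssP l : l \in ss -> exists2 B, B \in P & l = enum B.
  by case/mapP=> B; rewrite mem_enum; exists B.
have ss_all i : i \in flatten ss.
  have iP : i \in cover P by rewrite covP inE.
  apply/flatten_mapP; exists (pblock P i); first by rewrite mem_enum pblock_mem.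
  by rewrite mem_enum mem_pblock.
have ss_uniq : uniq (flatten ss).
  rewrite /ss; have := enum_uniq (mem P).
  have: {subset enum P <= P} by move=> B; rewrite mem_enum.
  elim: (enum P) => [|B Bs IHBs] //= sub /andP[BBs uBs].
  rewrite cat_uniq enum_uniq IHBs //; last by move=> C CBs; apply: sub; rewrite inE CBs orbT.
  rewrite andbT; apply/hasPn => i /flatten_mapP[C CBs]; rewrite !mem_enum => iC.
  have CP : C \in P by apply: sub; rewrite inE CBs orbT.
  apply: contraL CBs => iB; rewrite -(def_pblock tiP CP iC).
  by rewrite (def_pblock tiP (sub _ (mem_head _ _)) iB).
apply/ffunP => s; rewrite (weight_linear ss_uniq ss_all) => [|l /ssP[B BP ->]]; last first.
  exact: enum_comp.
by rewrite ffunE /ss big_map big_enum.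
Qed.

(** * A Riordan tree for each noncrossing partition *)

Section Construction.
Variables (n : nat) (P : {set {set 'I_n}}).
Hypothesis riordanP : P \in riordan_set n.

Let w := partition_word P.
(** Cyclic successor and predecessor in the block; the last label has letter e and its
successor, the first label, has letter f. *)
Let succ i := next (enum (pblock P i)) i.
Let pred i := prev (enum (pblock P i)) i.

Let mem_block i : i \in pblock P i.
Proof.
have /riordan_setP[/and3P[/eqP covP _ _] _ _] := riordanP.
by rewrite mem_pblock covP inE.
Qed.

Let pblock_eq i j : j \in pblock P i -> pblock P j = pblock P i.
Proof.
have /riordan_setP[/and3P[/eqP covP tiP _] _ _] := riordanP.
by move=> ji; apply: def_pblock ji; rewrite // pblock_mem // covP inE.
Qed.

Let succK : cancel succ pred.
Proof.
move=> i; rewrite /pred (@pblock_eq i) ?prev_next ?enum_uniq //.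
by rewrite -mem_enum mem_next mem_enum mem_block.
Qed.

Let predK : cancel pred succ.
Proof.
move=> i; rewrite /succ (@pblock_eq i) ?next_prev ?enum_uniq //.
by rewrite -mem_enum mem_prev mem_enum mem_block.
Qed.

Let succ_f i : (w (succ i) == sl2_f) = (w i == sl2_e).
Proof.
have /riordan_setP[/and3P[/eqP covP tiP _] _ _] := riordanP.
have iP : pblock P i \in P by rewrite pblock_mem // covP inE.
pose e i j := (w j == sl2_f) == (w i == sl2_e).
suff cyc : cycle e (enum (pblock P i)).
  have iB : i \in enum (pblock P i) by rewrite mem_enum.
  exact: eqP (next_cycle cyc iB).
have [i0 [l [i1 [-> w0 wl w1]]]] := block_shape riordanP iP; rewrite /cycle.
have: w i0 != sl2_e by rewrite w0.
elim: l {1 2}i0 wl => [|j l IHl] x /= wl wx; rewrite /e.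
  by rewrite w1 w0 (negbTE wx).
case/andP: wl => /eqP wj wl; rewrite wj (negbTE wx) /=.
by apply: IHl; rewrite // wj.
Qed.

Let pred_e i : (w (pred i) == sl2_e) = (w i == sl2_f).
Proof. by rewrite -succ_f predK. Qed.

(** The half-edges of label i: None is at its univalent vertex; the others are at its
trivalent vertex, Some None on the leg, Some (Some true) leading to the larger labels
of the block and Some (Some false) to the smaller ones. *)
Let slot := ('I_n * option (option bool))%type.

Let valid (h : slot) := (h.2 == None) || (w h.1 == sl2_h).
(** The half-edge of j through which the path arrives from the smaller labels,
respectively through which it leaves to the larger ones. *)
Let toward j : slot := if w j == sl2_h then (j, Some (Some false)) else (j, None).
Let away j : slot := if w j == sl2_h then (j, Some (Some true)) else (j, None).

Let slot_opp (h : slot) : slot :=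
  match h with
  | (i, None) => if w i == sl2_h then (i, Some None)
                 else if w i == sl2_f then toward (succ i) else away (pred i)
  | (i, Some None) => (i, None)
  | (i, Some (Some true)) => toward (succ i)
  | (i, Some (Some false)) => away (pred i)
  end.

Let slot_nxt (h : slot) : slot :=
  match h with
  | (i, None) => (i, None)
  | (i, Some None) => (i, Some (Some true))
  | (i, Some (Some true)) => (i, Some (Some false))
  | (i, Some (Some false)) => (i, Some None)
  end.

Let valid_toward j : valid (toward j).
Proof. by rewrite /valid /toward; case: ifP. Qed.

Let valid_away j : valid (away j).
Proof. by rewrite /valid /away; case: ifP. Qed.

Let valid_opp h : valid h -> valid (slot_opp h).
Proof.
case: h => i [[[]|]|] //= _.
case: ifP => [wi|_]; first by rewrite /valid /= wi.
by case: ifP => _; [exact: valid_toward | exact: valid_away].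
Qed.

Let valid_nxt h : valid h -> valid (slot_nxt h).
Proof. by case: h => i [[[]|]|]. Qed.

Let opp_toward j : w j != sl2_f -> slot_opp (toward j) = away (pred j).
Proof. by rewrite /toward; case: ifP => wj //= /negbTE->; rewrite wj. Qed.

Let opp_away j : w j != sl2_e -> slot_opp (away j) = toward (succ j).
Proof.
rewrite /away; case: ifP => wj //= we; rewrite wj ifT //.
by move: wj we; elim/sl2_ind: (w j).
Qed.

Let toward_f i : w i != sl2_e -> w (succ i) != sl2_f.
Proof. by rewrite succ_f. Qed.

Let away_e i : w i != sl2_f -> w (pred i) != sl2_e.
Proof. by rewrite pred_e. Qed.

Let slot_oppK h : valid h -> slot_opp (slot_opp h) = h.
Proof.
have sE i : w i != sl2_e -> slot_opp (toward (succ i)) = away i.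
  by move=> we; rewrite opp_toward ?toward_f // succK.
have pE i : w i != sl2_f -> slot_opp (away (pred i)) = toward i.
  by move=> wf; rewrite opp_away ?away_e // predK.
case: h => i [[[]|]|] /=.
- by rewrite /valid /= => wi; rewrite sE /away ?wi // (eqP wi).
- by rewrite /valid /= => wi; rewrite pE /toward ?wi // (eqP wi).
- by rewrite /valid /= => ->.
move=> _; case: (boolP (w i == sl2_h)) => [//|wh].
case: (boolP (w i == sl2_f)) => [wf|wf].
  by rewrite sE /away ?(negbTE wh) // (eqP wf).
by rewrite pE /toward ?(negbTE wh).
Qed.

Let slot_opp_neq h : valid h -> slot_opp h != h.
Proof.
case: h => i [[[]|]|] //=.
- by rewrite /toward; case: ifP => *; rewrite xpair_eqE andbF.
- by rewrite /away; case: ifP => *; rewrite xpair_eqE andbF.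
- by move=> _; rewrite xpair_eqE andbF.
move=> _; case: ifP => [_|wh]; first by rewrite xpair_eqE andbF.
case: ifP => wf; apply/negP.
  rewrite /toward; case: ifP => _ /eqP[] // si.
  by have := succ_f i; rewrite si wf (eqP wf).
rewrite /away; case: ifP => _ /eqP[] // pi.
by have := pred_e i; rewrite pi wf; elim/sl2_ind: (w i) wf wh.
Qed.

Let slot_nxt3 h : slot_nxt (slot_nxt (slot_nxt h)) = h.
Proof. by case: h => i [[[]|]|]. Qed.

Let half := {h : slot | valid h}.
Let half_opp (h : half) : half := exist valid _ (valid_opp (valP h)).
Let half_nxt (h : half) : half := exist valid _ (valid_nxt (valP h)).
Let half_leg (i : 'I_n) : half := exist valid (i, None) isT.

Let half_oppK : involutive half_opp.
Proof. by move=> [h hv]; apply/val_inj/slot_oppK. Qed.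

Let half_opp_neq h : half_opp h != h.
Proof. by rewrite -(inj_eq val_inj) slot_opp_neq // valP. Qed.

Let half_nxt3 h : half_nxt (half_nxt (half_nxt h)) = h.
Proof. exact/val_inj/slot_nxt3. Qed.

Let half_leg_inj : injective half_leg.
Proof. by move=> i j []. Qed.

Let half_legP h : (half_nxt h == h) = (h \in codom half_leg).
Proof.
apply/eqP/codomP => [|[i ->]]; last exact/val_inj.
case: h => [[i [[[]|]|]] hv] // _; exists i; exact/val_inj.
Qed.

Let half_component (h : half) : exists i,
  connect (fun x y => (y == half_opp x) || (y == half_nxt x)) h (half_leg i).
Proof.
pose e := fun x y : half => (y == half_opp x) || (y == half_nxt x).
have e_opp x : connect e x (half_opp x) by rewrite connect1 // /e eqxx.
have e_nxt x : connect e x (half_nxt x) by rewrite connect1 // /e eqxx orbT.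
case: h => -[i t] hv; exists i; rewrite -/e.
have foot hf : connect e (exist valid (i, Some None) hf) (half_leg i).
  apply: connect_trans (e_opp _) _.
  by rewrite (_ : half_opp _ = half_leg i) //; apply/val_inj.
have inward hf : connect e (exist valid (i, Some (Some false)) hf) (half_leg i).
  apply: connect_trans (e_nxt _) _; exact: foot.
case: t hv => [[[]|]|] hv.
- apply: connect_trans (e_nxt _) _; exact: inward.
- exact: inward.
- exact: foot.
by rewrite (_ : exist valid _ _ = half_leg i) //; apply/val_inj.
Qed.

Definition partition_diagram : jacobi_diagram n :=
  JacobiDiagram half_oppK half_opp_neq half_nxt3 half_leg_inj half_legP half_component.

Let slot_of (h : half_edge partition_diagram) : slot := val (h : half).

Let slot_of_inj : injective slot_of. Proof. exact: val_inj. Qed.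

Let slot_of_opp h : slot_of (Defs.opp partition_diagram h) = slot_opp (slot_of h).
Proof. by []. Qed.

Let slot_of_nxt h : slot_of (nxt partition_diagram h) = slot_nxt (slot_of h).
Proof. by []. Qed.

Let slot_of_leg i : slot_of (leg partition_diagram i) = (i, None).
Proof. by []. Qed.

Lemma partition_diagram_path i l i1 (h : half_edge partition_diagram) :
  slot_of h = away i -> w i != sl2_e -> path (frel succ) i (rcons l i1) ->
  all (fun i => w i == sl2_h) l -> w i1 = sl2_e -> path_from h (rcons l i1).
Proof.
elim: l i h => [|j l IHl] i h hE wi.
  rewrite /= andbT => /eqP si _ w1; rewrite -(inj_eq slot_of_inj) slot_of_opp hE.
  by rewrite opp_away // si /toward w1 slot_of_leg.
rewrite rcons_cons => /andP[/eqP si pl] /andP[wj wl] w1.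
rewrite path_from_cons ?size_rcons //.
have wje : w j != sl2_e by rewrite (eqP wj).
have footE : slot_of (foot partition_diagram j) = (j, Some None).
  by rewrite slot_of_opp slot_of_leg /= wj.
apply/and3P; split.
- by rewrite /trivalent -(inj_eq slot_of_inj) slot_of_nxt footE xpair_eqE andbF.
- rewrite -(inj_eq slot_of_inj) !slot_of_nxt footE slot_of_opp hE opp_away // si.
  by rewrite /toward wj.
- apply: IHl pl wl w1 => //.
  by rewrite slot_of_nxt footE /away wj.
Qed.

Lemma partition_diagram_component B : B \in P ->
  linear_component partition_diagram (enum B).
Proof.
move=> BP; have [i0 [l [i1 [eB w0 wl w1]]]] := block_shape riordanP BP.
have /riordan_setP[/and3P[_ tiP _] _ _] := riordanP.
have : path (frel succ) i0 (rcons l i1).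
  have := cycle_next (enum_uniq (mem B)); rewrite eB /cycle rcons_path => /andP[+ _].
  have sub x : x \in i0 :: rcons l i1 -> succ x = next (i0 :: rcons l i1) x.
    by rewrite -eB mem_enum => xB; rewrite /succ (def_pblock tiP BP xB).
  rewrite (@eq_in_path _ (mem (i0 :: rcons l i1)) _ (frel succ)) //.
    by move=> x y xB _; rewrite /= sub.
  by apply/allP.
rewrite /linear_component eB -[uniq _]/(uniq (i0 :: rcons l i1)) -eB enum_uniq => pl.
by apply: partition_diagram_path pl wl w1; rewrite ?w0 // /away w0.
Qed.

End Construction.

Lemma partition_diagram_components n (P : {set {set 'I_n}})
    (riordanP : P \in riordan_set n) B :
  B \in P -> exists s : seq 'I_n,
    [/\ s =i B, ordered_labels s & linear_component (partition_diagram riordanP) s].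
Proof.
move=> BP; exists (enum B); split=> [i||]; first by rewrite mem_enum.
  exact: sorted_enum_ord.
exact: partition_diagram_component.
Qed.

(** * The basis *)

Theorem theorem3p2 (R : realType) (n : nat) (hn : (1 <= n)%N) :
  set_is_basis (Inv n) (fun v : tensor n =>
    exists2 T : jacobi_diagram n, riordan_tree R T & v = W T).
Proof.
pose X := [seq partition_tensor P | P <- enum (riordan_set n)].
have X_free : free X.
  apply: free_partition_tensor => [P /riordan_setP[] //|P|]; last exact: partition_word_inj.
  by case/riordan_setP=> _ P2 _; exact: P2.
exists X.
  move=> v; split=> [/mapP[P]|[T [P riordanP comps] ->]].
    rewrite mem_enum => riordanP ->.
    have riordanP' : riordan_partition R P by apply/riordan_partitionE.
    have comps := partition_diagram_components riordanP.
    exists (partition_diagram riordanP); first by exists P.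
    by rewrite (riordan_tree_weight riordanP' comps).
  rewrite (riordan_tree_weight riordanP comps) map_f // mem_enum.
  by have /riordan_partitionE := riordanP.
have X_Inv : (<<X>> <= Inv n)%VS.
  apply/span_subvP => v /mapP[P]; rewrite mem_enum => /riordan_setP[partP P2 _] ->.
  exact: partition_tensor_Inv.
rewrite basisEfree X_free X_Inv size_map -cardE.
by rewrite (leq_trans (dim_Inv n)) // card_admissible.
Qed.
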